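(* Let $n\ge0$ and let $\sigma,\tau\in\mathrm{Typ}(n)$ be types of $n$. The coefficient of $E^+_\tau$ in the expansion of $E_\sigma$ in the basis $\{E^+_\rho:\rho\in\mathrm{Typ}(n)\}$ is $$(-1)^{\ell(\tau)}\,|\mathcal{PT}^{\mathrm{dyad}}(\sigma, \tau)|.$$
   Context: A type of $n$ is a sequence $\tau=(\tau|^1,\tau|^2,\dots)$ of (possibly empty) integer partitions with $\sum_{i\ge1} i\,|\tau|^i|=n$, where $|\tau|^i|$ is the size of the partition $\tau|^i$; $\mathrm{Typ}(n)$ is the set of types of $n$. Its length is $\ell(\tau)=\sum_i\ell(\tau|^i)$. Each part $d$ of $\tau|^r$ gives a block $d^r$ of $\tau$ (degree $d$, multiplicity $r$; not exponentiation); a type is thus a multiset of blocks. Let $x_{i,j}$ ($i,j\ge 1$) be indeterminates with $\deg x_{i,j}=i$; all series have rational coefficients. A monomial is square-free if every exponent is at most $1$. $E^+_d$ is the sum of all square-free monomials of degree $d$; $E_d$ is the sum over square-free monomials $f$ of degree $d$ of $(-1)^{m(f)}f$, where $m(f)$ is the number of indeterminates in $f$. For $F\in\{E,E^+\}$, $F_{d^r}$ is obtained from $F_d$ by replacing each $x_{i,j}$ by $x_{i,j}^r$, and $F_\tau=\prod F_{d^r}$ over all blocks $d^r$ of $\tau$ (counted with repetition; empty product $=1$). It is known that $\{F_\tau\}_{\tau\in\mathrm{Typ}(n)}$ is, for each such $F$, a $\mathbb{Q}$-basis of the space $\mathrm{PSym}(n)$ of polysymmetric functions of degree $n$ (power series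 homogeneous of degree $n$ that are symmetric separately in each variable set $\{x_{i,j}\}_{j\ge1}$). The diagram of a partition $\lambda$ has left-justified rows of $\lambda_1,\lambda_2,\dots$ cells; the tensor diagram of $\sigma$ is the sequence of diagrams of $\sigma|^1,\sigma|^2,\dots$, the $i$th one being called the $i$th tensor factor. A brick is a nonempty set of consecutive cells in one row; its length is its number of cells. For $k\ge0$, a $k$-brick is a brick whose length is a multiple of $2^k$, carrying the marking $k$. A dyadic polybrick tabloid of shape $\sigma$ and content $\tau$ is a decomposition of the tensor diagram of $\sigma$ into disjoint $k$-bricks (for various $k\ge0$, the markings being part of the data) such that, in each row, whenever $k'>k$ every $k'$-brick appears to the right of every $k$-brick, and such that $\tau$ is the multiset of blocks obtained by taking a block $b^{2^k m}$ for each $k$-brick of length $2^k b$ in the $m$th tensor factor. $\mathcal{PT}^{\mathrm{dyad}}(\sigma,\tau)$ is the set of these. *)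

(* Defs.v *)
From HB Require Import structures.
From mathcomp Require Import all_boot all_order all_algebra.
From mathcomp Require Import finmap.
From mathcomp Require Import monalg.

Set Implicit Arguments.
Unset Strict Implicit.
Unset Printing Implicit Defensive.

Import GRing.Theory.

Local Open Scope nat_scope.

Definition is_partition (s : seq nat) : bool := sorted geq s && (0 \notin s).

(* In a type of n the partitions of index > n are empty, so a type is recorded
   by its first n partitions.  Lists are indexed from 0: the partition written
   tau|^(i+1) is [nth [::] tau i]. *)
Definition is_type (n : nat) (t : seq (seq nat)) : bool :=
  [&& size t == n, all is_partition t
    & \sum_(i < n) i.+1 * sumn (nth [::] t i) == n].

Record Typ (n : nat) : predArgType :=
  MkTyp { typ_val :> seq (seq nat); _ : is_type n typ_val }.

HB.instance Definition _ n := [isSub for @typ_val n].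
HB.instance Definition _ n := [Countable of Typ n by <:].

Section TypFinite.
Variable n : nat.

Definition typ_encode (t : Typ n) : {ffun 'I_n * 'I_n -> 'I_n.+1} :=
  [ffun p : 'I_n * 'I_n => inord (nth 0 (nth [::] t p.1) p.2)].

Definition typ_decode (f : {ffun 'I_n * 'I_n -> 'I_n.+1}) : option (Typ n) :=
  insub [seq [seq k <- [seq (f (i, j) : nat) | j <- enum 'I_n] | 0 < k]
        | i <- enum 'I_n].

Lemma size_le_sumn (s : seq nat) : 0 \notin s -> size s <= sumn s.
Proof.
elim: s => //= x s IH; rewrite inE negb_or eq_sym -lt0n => /andP[x0 /IH h].
by rewrite -add1n leq_add.
Qed.

Lemma nth_le_sumn (s : seq nat) j : nth 0 s j <= sumn s.
Proof.
elim: s j => [|x s IH] [|j] //=; first exact: leq_addr.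
exact: leq_trans (IH j) (leq_addl _ _).
Qed.

Lemma typ_encodeK : pcancel typ_encode typ_decode.
Proof.
move=> t; rewrite /typ_decode -[RHS](valK t); congr insub.
case: t => t /=; rewrite /is_type => H; have /and3P[/eqP sz /allP pt /eqP sm] := H.
apply: (@eq_from_nth _ [::]); first by rewrite size_map size_enum_ord sz.
move=> i; rewrite size_map size_enum_ord => lt_in.
rewrite (nth_map (Ordinal lt_in)) ?size_enum_ord //.
have -> : nth (Ordinal lt_in) (enum 'I_n) i = Ordinal lt_in.
  by apply: val_inj; rewrite /= nth_enum_ord.
set s := nth [::] t i.
have le_s : sumn s <= n.
  rewrite -[X in _ <= X]sm (bigD1 (Ordinal lt_in)) //=.
  by apply: leq_trans (leq_addr _ _); rewrite leq_pmull.
have /pt/andP[_ s0] : s \in t by rewrite mem_nth ?sz.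
have szs : size s <= n := leq_trans (size_le_sumn s0) le_s.
transitivity [seq k <- [seq nth 0 s j | j <- iota 0 n] | 0 < k].
  congr filter; rewrite -val_enum_ord -map_comp.
  apply: eq_map => j /=; rewrite ffunE /= inordK // ltnS.
  exact: leq_trans (nth_le_sumn _ _) le_s.
rewrite -(subnKC szs) iotaD map_cat filter_cat map_nth_iota0 // take_size.
rewrite [X in _ ++ X](_ : _ = [::]) ?cats0.
  by apply/all_filterP/allP => x xs; rewrite lt0n; apply: contraNneq s0 => <-.
apply/eqP; rewrite -size_eq0 size_filter -leqn0 leqNgt -has_count.
apply/hasPn => x /mapP[j]; rewrite mem_iota add0n => /andP[hj _] ->{x}.
by rewrite nth_default.
Qed.

End TypFinite.

HB.instance Definition _ n : isFinite (Typ n) := PCanIsFinite (@typ_encodeK n).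

Definition typ_length (n : nat) (t : Typ n) : nat :=
  \sum_(i < n) size (nth [::] t i).

(* The pair (d, r) stands for the block d^r. *)
Definition blocks (n : nat) (t : Typ n) : seq (nat * nat) :=
  [seq (d, i.+1) | i <- iota 0 n, d <- nth [::] t i].

(* The pair (i, j) stands for the indeterminate x_{i+1,j+1}, of degree i+1. *)
Definition indet : choiceType := (nat * nat)%type.
Definition monomial : choiceType := {cmonom indet}.

Definition wdeg (m : monomial) : nat :=
  \sum_(x <- finsupp m) m x * x.1.+1.

Definition square_free (m : monomial) : bool :=
  [forall x : finsupp m, m (val x) <= 1].

Definition divisors (m : monomial) : seq monomial :=
  [seq ([cmonom (u x : nat) | x : finsupp m]%M : monomial)
  | u : {dffun forall x : finsupp m, 'I_(m (val x)).+1}].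

Lemma divisors_uniq m : uniq (divisors m).
Proof.
rewrite map_inj_uniq ?enum_uniq // => u v e.
apply/ffunP => x; apply: val_inj.
have := congr1 (fun w : monomial => w (val x)) e.
rewrite !cmE /= !fsfun_ffun.
by case: insubP => [y _ /val_inj -> //|]; rewrite (valP x).
Qed.

Lemma mem_divisors (m d : monomial) :
  (d \in divisors m) <-> (mulcm d (divcm m d) = m).
Proof.
have leP (e : monomial) :
    (mulcm e (divcm m e) = m) <-> (forall x, e x <= m x).
  split=> [<- x|le]; first by rewrite cmM leq_addr.
  apply/eqP/cmP => x; rewrite cmM !cmE /= fsfun_fun.
  case: finsuppP => [xm|_]; last by rewrite subnKC.
  by move: (le x); rewrite (fsfun_dflt xm) leqn0 => /eqP ->.
split=> [/mapP[u _ ->]|/leP le].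
  apply/leP => x; rewrite cmE /= fsfun_ffun.
  by case: insubP => [y _ <-|//]; rewrite -ltnS ltn_ord.
pose f (x : finsupp m) : 'I_(m (val x)).+1 := inord (d (val x)).
apply/mapP; exists (finfun f) => //.
  by rewrite mem_enum.
apply/eqP/cmP => x; rewrite cmE /= fsfun_ffun.
case: insubP => [y _ <-|].
  apply/esym; apply: etrans (congr1 val (ffunE f y)) _.
  by rewrite /f /= inordK // ltnS.
by move=> /fsfun_dflt e; move: (le x); rewrite e leqn0 => /eqP ->.
Qed.

Local Open Scope ring_scope.

Definition series : Type := monomial -> rat.

Definition series1 : series := fun m => (m == onecm indet)%:R.

Definition mul_series (f g : series) : series :=
  fun m => \sum_(d <- divisors m) f d * g (divcm m d).

Definition Eplus (d : nat) : series :=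
  fun m => if square_free m && (wdeg m == d) then 1 else 0.

Definition Eminus (d : nat) : series :=
  fun m => if square_free m && (wdeg m == d) then (-1) ^+ #|` finsupp m| else 0.

(* The series obtained from f by replacing every x_{i,j} by x_{i,j}^r; used for
   r >= 1 only. *)
Definition subst_pow (r : nat) (f : series) : series :=
  fun m => if [forall x : finsupp m, (r %| m (val x))%N]
           then f ([cmonom (m x %/ r)%N | x in finsupp m]%M)
           else 0.

Definition at_type (F : nat -> series) (n : nat) (t : Typ n) : series :=
  foldr mul_series series1 [seq subst_pow b.2 (F b.1) | b <- blocks t].

Definition is_expansion (n : nat) (B : Typ n -> series) (f : series)
    (c : {ffun Typ n -> rat}) : Prop :=
  forall m : monomial, f m = \sum_(rho : Typ n) c rho * B rho m.

Local Close Scope ring_scope.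

(* (m, i, j) is the cell in column j+1 of row i+1 of the (m+1)st tensor factor.
   In the tensor diagram of a type of n all three indices are less than n. *)
Definition cell (n : nat) : finType := ('I_n * 'I_n * 'I_n)%type.

Definition tensor_diagram (n : nat) (s : Typ n) : {set cell n} :=
  [set c : cell n | c.2 < nth 0 (nth [::] s c.1.1) c.1.2].

(* A marked brick (m, i, J, k) occupies the columns J of row i of factor m and
   carries the marking k.  Since 2 ^ k divides its length, which is at least 1
   and at most n, the bound k < n excludes no brick. *)
Definition marked_brick (n : nat) : finType :=
  ('I_n * 'I_n * {set 'I_n} * 'I_n)%type.

Section Bricks.
Variable n : nat.
Implicit Types b : marked_brick n.

Definition brick_factor b : 'I_n := b.1.1.1.
Definition brick_row b : 'I_n := b.1.1.2.
Definition brick_cols b : {set 'I_n} := b.1.2.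
Definition brick_mark b : nat := b.2.
Definition brick_length b : nat := #|brick_cols b|.

Definition brick_cells b : {set cell n} :=
  [set c : cell n | [&& c.1.1 == brick_factor b, c.1.2 == brick_row b
                      & c.2 \in brick_cols b]].

Definition is_brick b : bool :=
  [exists a : 'I_n, exists z : 'I_n,
     (a <= z) && (brick_cols b == [set j : 'I_n | a <= j <= z])]
  && (2 ^ brick_mark b %| brick_length b).

Definition same_row b b' : bool :=
  (brick_factor b == brick_factor b') && (brick_row b == brick_row b').

Definition right_of b' b : bool :=
  [forall j in brick_cols b, forall j' in brick_cols b', j < j'].

Definition brick_block b : nat * nat :=
  (brick_length b %/ 2 ^ brick_mark b, 2 ^ brick_mark b * (brick_factor b).+1).

End Bricks.

Definition is_dyadic_tabloid (n : nat) (s t : Typ n)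
    (T : {set marked_brick n}) : bool :=
  [&& [forall b in T, is_brick b],
      [forall b in T, forall b' in T,
         (b != b') ==> [disjoint brick_cells b & brick_cells b']],
      \bigcup_(b in T) brick_cells b == tensor_diagram s,
      [forall b in T, forall b' in T,
         same_row b b' && (brick_mark b < brick_mark b') ==> right_of b' b]
    & perm_eq (blocks t) [seq brick_block b | b <- enum T]].

Definition PT_dyad (n : nat) (s t : Typ n) : {set {set marked_brick n}} :=
  [set T : {set marked_brick n} | is_dyadic_tabloid s t T].

(* Main.v *)
(* From 1 - x = (1 - x ^ 2) / (1 + x), taken over all indeterminates, the series
   E_l satisfy  E_l = [l even] E_{l/2}(x^2) - sum_{c >= 1} E^+_c E_{l-c}.
   Read at level 2^k this is the recursion for signed tilings of one row whose
   bricks have marking at least k: either no brick has marking exactly k, or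
   the leftmost brick is a k-brick, which is peeled off.  Multiplying over the
   rows and grouping the tilings by content gives the expansion.
   It is unique because the E^+_t are triangular: give every block d^r of t an
   indeterminate of degree d of its own and take the product of their r-th
   powers.  If this monomial occurs in E^+_u, then the sum of the multiplicities
   r of u is at most that of t, and in case of equality u has at least as many
   blocks as t, with equality only if u = t. *)

From HB Require Import structures.
From mathcomp Require Import all_boot all_order all_algebra.
From mathcomp Require Import finmap monalg.
From mathcomp Require Import boolp zify.
Require Import Defs.

Set Implicit Arguments.
Unset Strict Implicit.
Unset Printing Implicit Defensive.

Import Order.TTheory GRing.Theory Num.Theory.

Local Open Scope ring_scope.

(** * Monomials and their divisors *)

Lemma cmonomP (m m' : monomial) : (forall x : indet, m x = m' x) -> m = m'.
Proof. by move=> e; apply/eqP/cmP. Qed.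

Lemma divisorsP (d m : monomial) :
  reflect (forall x, d x <= m x)%N (d \in divisors m).
Proof.
apply: (iffP idP) => [/mem_divisors <- x|le]; first by rewrite cmM leq_addr.
by apply/mem_divisors/cmonomP => x; rewrite mulcmE divcmE subnKC.
Qed.

(** Multiplication by [d] matches the divisors of m/d with the divisors of m that are multiples of
    d; this reindexes the inner sum in [mul_seriesA]. *)
Lemma perm_divisorsB (d m : monomial) : d \in divisors m ->
  perm_eq (divisors (divcm m d))
    [seq divcm c d | c <- divisors m & d \in divisors c].
Proof.
move=> /divisorsP dm; apply: uniq_perm; rewrite ?divisors_uniq //.
  rewrite map_inj_in_uniq ?filter_uniq ?divisors_uniq //.
  move=> c c'; rewrite !mem_filter => /andP[/divisorsP h _] /andP[/divisorsP h' _] e.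
  apply: cmonomP => x; have : divcm c d x = divcm c' d x by rewrite e.
  by rewrite !divcmE; have := h x; have := h' x; lia.
move=> e; apply/divisorsP/mapP => [h|[c]].
  exists (mulcm d e); last by apply: cmonomP => x; rewrite divcmE mulcmE addKn.
  rewrite mem_filter; apply/andP; split; apply/divisorsP => x; rewrite mulcmE ?leq_addr //.
  by have := h x; have := dm x; rewrite divcmE; lia.
rewrite mem_filter => /andP[_ /divisorsP h] -> x.
by rewrite !divcmE leq_sub2r.
Qed.

Lemma perm_divisors_filter (c m : monomial) : c \in divisors m ->
  perm_eq (divisors c) [seq d <- divisors m | d \in divisors c].
Proof.
move=> /divisorsP cm; apply: uniq_perm; rewrite ?filter_uniq ?divisors_uniq //.
move=> d; rewrite mem_filter; apply/idP/andP => [h|[]//]; split=> //.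
by apply/divisorsP => x; apply: leq_trans (cm x); apply/divisorsP: x.
Qed.

Lemma perm_divisorsC (m : monomial) :
  perm_eq (divisors m) [seq divcm m d | d <- divisors m].
Proof.
have K (d : monomial) : d \in divisors m -> divcm m (divcm m d) = d.
  by move=> /divisorsP h; apply: cmonomP => x; rewrite !divcmE subKn.
apply: uniq_perm; rewrite ?divisors_uniq //.
  rewrite map_inj_in_uniq ?divisors_uniq // => d d' h h' e.
  by rewrite -(K _ h) e K.
have div d : divcm m d \in divisors m.
  by apply/divisorsP => x; rewrite divcmE leq_subr.
move=> d; apply/idP/mapP => [h|[e _ ->] //].
by exists (divcm m d); rewrite ?K.
Qed.

(** * The commutative ring of power series *)

HB.instance Definition _ := gen_eqMixin series.
HB.instance Definition _ := gen_choiceMixin series.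

Section SeriesRing.
Implicit Types f g h : series.

Definition add_series f g : series := fun m => f m + g m.
Definition opp_series f : series := fun m => - f m.

Fact add_seriesA : associative add_series.
Proof. by move=> f g h; apply/funext => m; rewrite /add_series addrA. Qed.
Fact add_seriesC : commutative add_series.
Proof. by move=> f g; apply/funext => m; rewrite /add_series addrC. Qed.
Fact add_series0 : left_id (fun=> 0) add_series.
Proof. by move=> f; apply/funext => m; rewrite /add_series add0r. Qed.
Fact add_seriesN : left_inverse (fun=> 0) opp_series add_series.
Proof. by move=> f; apply/funext => m; rewrite /add_series addNr. Qed.

HB.instance Definition _ :=
  GRing.isZmodule.Build series add_seriesA add_seriesC add_series0 add_seriesN.

Fact mul_seriesC : commutative mul_series.
Proof.
move=> f g; apply/funext => m; rewrite /mul_series.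
rewrite (perm_big _ (perm_divisorsC m)) /= big_map big_seq [RHS]big_seq.
apply: eq_bigr => d /divisorsP h; rewrite mulrC; congr (g _ * _).
by apply: cmonomP => x; rewrite !divcmE subKn.
Qed.

Fact mul_seriesA : associative mul_series.
Proof.
move=> f g h; apply/funext => m; rewrite /mul_series.
(* Both bracketings are sums over the chains d | c | m of f(d) g(c/d) h(m/c). *)
transitivity (\sum_(d <- divisors m) \sum_(c <- divisors m | d \in divisors c)
   f d * g (divcm c d) * h (divcm m c)).
  rewrite big_seq [RHS]big_seq; apply: eq_bigr => d dm.
  rewrite (perm_big _ (perm_divisorsB dm)) /= big_map big_filter big_distrr /=.
  rewrite big_seq_cond [RHS]big_seq_cond; apply: eq_bigr => c /andP[cm dc].
  rewrite mulrA; congr (_ * h _); apply: cmonomP => x.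
  by rewrite !divcmE; move/divisorsP/(_ x): cm; move/divisorsP/(_ x): dc; lia.
rewrite (exchange_big_dep xpredT) //= big_seq [RHS]big_seq; apply: eq_bigr => c cm.
by rewrite [in RHS](perm_big _ (perm_divisors_filter cm)) /= big_filter big_distrl.
Qed.

Fact mul_series1 : left_id series1 mul_series.
Proof.
move=> f; apply/funext => m; rewrite /mul_series (bigD1_seq (onecm indet)) /=.
- rewrite /series1 eqxx mul1r big1 ?addr0 => [|d /negbTE->]; last by rewrite mul0r.
  by congr f; apply: cmonomP => x; rewrite divcmE onecmE subn0.
- by apply/divisorsP => x; rewrite onecmE.
- exact: divisors_uniq.
Qed.

Fact mul_seriesDl : left_distributive mul_series +%R.
Proof.
move=> f g h; apply/funext => m; rewrite /GRing.add /= /add_series /mul_series.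
by rewrite -big_split; apply: eq_bigr => d _; rewrite mulrDl.
Qed.

Fact series1_neq0 : series1 != 0.
Proof.
apply/eqP => /(congr1 (fun f : series => f (onecm indet))).
by rewrite /series1 eqxx => /eqP; rewrite oner_eq0.
Qed.

HB.instance Definition _ := GRing.Zmodule_isComNzRing.Build series
  mul_seriesA mul_seriesC mul_series1 mul_seriesDl series1_neq0.

Lemma series1E m : (1 : series) m = (m == onecm indet)%:R.
Proof. by []. Qed.

Lemma add_seriesE f g m : (f + g) m = f m + g m.
Proof. by []. Qed.

Lemma opp_seriesE f m : (- f) m = - f m.
Proof. by []. Qed.

Lemma sum_seriesE (I : Type) (r : seq I) (P : pred I) (F : I -> series) m :
  (\sum_(i <- r | P i) F i) m = \sum_(i <- r | P i) F i m.
Proof. exact: (big_morph (fun f : series => f m)). Qed.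

Lemma mul_seriesE f g m :
  (f * g) m = \sum_(d <- divisors m) f d * g (divcm m d).
Proof. by []. Qed.

End SeriesRing.

(** * The substitution of r-th powers for the indeterminates *)

Definition pow_monomial (r : nat) (m : monomial) : monomial :=
  [cmonom m x * r | x in finsupp m]%M.

Lemma pow_monomialE r m x : pow_monomial r m x = (m x * r)%N.
Proof. by rewrite /pow_monomial cmE fsfun_fun; case: finsuppP. Qed.

Lemma pow_monomial_inj r : (0 < r)%N -> injective (pow_monomial r).
Proof.
move=> r0 m m' e; apply: cmonomP => x; apply/eqP.
by rewrite -(eqn_pmul2r r0) -!pow_monomialE e.
Qed.

Section SubstPow.
Variable r : nat.
Hypothesis r_gt0 : (0 < r)%N.
Implicit Types (f g : series) (m : monomial).

Lemma subst_powE f m : subst_pow r f (pow_monomial r m) = f m.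
Proof.
rewrite /subst_pow; case: ifP => [_|/forallP[]] /=; last first.
  by move=> x; rewrite pow_monomialE dvdn_mull.
congr f; apply: cmonomP => x; rewrite cmE fsfun_fun.
have := pow_monomialE r m x; case: finsuppP => [_ /esym/eqP|_ ->].
  by rewrite muln_eq0 (gtn_eqF r_gt0) orbF => /eqP.
by rewrite mulnK.
Qed.

(** Together with [subst_powE] this reduces an identity between substituted series to its values on
    r-th powers, since all of them vanish elsewhere. *)
Lemma subst_powP m :
  (exists m', m = pow_monomial r m') \/ (forall f, subst_pow r f m = 0).
Proof.
case: (boolP [forall x : finsupp m, (r %| m (val x))%N]) => [/forallP h|/negbTE h].
  left; exists [cmonom m x %/ r | x in finsupp m]%M; apply: cmonomP => x.
  rewrite pow_monomialE cmE fsfun_fun.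
  by case: finsuppP => [//|xm]; rewrite divnK //; apply: (h [` xm]%fset).
by right=> f; rewrite /subst_pow h.
Qed.

End SubstPow.

Lemma subst_powD r (f g : series) :
  subst_pow r (f + g) = subst_pow r f + subst_pow r g.
Proof.
apply/funext => m; rewrite add_seriesE /subst_pow.
by case: ifP => _; rewrite ?add_seriesE ?addr0.
Qed.

Lemma subst_pow0 r : subst_pow r (0 : series) = 0.
Proof. by apply/funext => m; rewrite /subst_pow if_same. Qed.

Lemma subst_pow_sum r (I : Type) (s : seq I) (P : pred I) (F : I -> series) :
  subst_pow r (\sum_(i <- s | P i) F i) = \sum_(i <- s | P i) subst_pow r (F i).
Proof. exact: (big_morph _ (subst_powD r) (subst_pow0 r)). Qed.

Lemma subst_pow_comp r s (f : series) : (0 < r)%N -> (0 < s)%N ->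
  subst_pow s (subst_pow r f) = subst_pow (r * s) f.
Proof.
move=> r0 s0; have rs0 : (0 < r * s)%N by rewrite muln_gt0 r0.
have powM m : pow_monomial (r * s) m = pow_monomial s (pow_monomial r m).
  by apply: cmonomP => x; rewrite !pow_monomialE mulnA.
apply/funext => m; case: (subst_powP (r * s) m) => [[m' ->]|h].
  by rewrite (subst_powE rs0) powM !subst_powE.
rewrite h; case: (subst_powP s m) => [[m' e]|-> //].
rewrite e subst_powE //; case: (subst_powP r m') => [[m'' e']|-> //].
(* Here m is an (rs)-th power after all, so [h] forces the remaining value of [f] to be 0. *)
by rewrite e' subst_powE // -(h f) e e' -powM subst_powE.
Qed.

Lemma subst_pow1 r : (0 < r)%N -> subst_pow r (1 : series) = 1.
Proof.
move=> r0; have e1 : pow_monomial r (onecm indet) = onecm indet.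
  by apply: cmonomP => x; rewrite pow_monomialE onecmE.
apply/funext => m; rewrite series1E; case: (subst_powP r m) => [[m' ->]|h].
  by rewrite subst_powE // series1E -{2}e1 (inj_eq (pow_monomial_inj r0)).
rewrite h; case: eqP => // e.
by have := h 1; rewrite e -{1}e1 subst_powE // series1E eqxx => ->.
Qed.

Lemma subst_powM r (f g : series) : (0 < r)%N ->
  subst_pow r (f * g) = subst_pow r f * subst_pow r g.
Proof.
move=> r0; apply/funext => m; rewrite [RHS]mul_seriesE.
case: (subst_powP r m) => [[m' ->{m}]|h]; last first.
  rewrite h big_seq big1 // => d /divisorsP dm.
  case: (subst_powP r d) => [[a da]|->]; last by rewrite mul0r.
  case: (subst_powP r (divcm m d)) => [[b db]|->]; last by rewrite mulr0.
  (* If d and m/d are both r-th powers, so is m. The constant function 1 detects the contradiction: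
     its substitution is 1 at every r-th power but 0 at m by [h]. *)
  have /esym/eqP : subst_pow r (fun=> 1) m = 1.
    rewrite (_ : m = pow_monomial r (mulcm a b)) ?subst_powE //.
    apply: cmonomP => x; rewrite pow_monomialE mulcmE mulnDl -!pow_monomialE.
    by rewrite -da -db divcmE subnKC.
  by rewrite h oner_eq0.
rewrite subst_powE // mul_seriesE.
(* Only divisors that are r-th powers contribute, and these are the r-th powers of the divisors of
   [m']. *)
set t := [seq pow_monomial r d | d <- divisors m'].
rewrite [RHS](bigID (mem t)) /= [X in _ = _ + X]big1_seq ?addr0; last first.
  move=> d /andP[dt /divisorsP dm]; case: (subst_powP r d) => [[a da]|->].
    case/mapP: dt; exists a => //; apply/divisorsP => x.
    by rewrite -(leq_pmul2r r0) -!pow_monomialE -da.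
  by rewrite mul0r.
rewrite -[RHS]big_filter [RHS](perm_big t) /=.
  rewrite [RHS]big_map; apply: eq_bigr => d _; rewrite subst_powE //.
  rewrite (_ : divcm (pow_monomial r m') _ = pow_monomial r (divcm m' d)) ?subst_powE //.
  by apply: cmonomP => x; rewrite divcmE !pow_monomialE divcmE mulnBl.
apply: uniq_perm; rewrite ?filter_uniq ?divisors_uniq //.
  by rewrite map_inj_uniq ?divisors_uniq //; apply: pow_monomial_inj.
move=> d; rewrite mem_filter; apply: andb_idr => /mapP[a /divisorsP h ->].
by apply/divisorsP => x; rewrite !pow_monomialE leq_pmul2r.
Qed.

(** * Series that factor over the indeterminates *)

Lemma prod_sum_dffun (R : comNzRingType) (I : finType) (T : I -> finType)
    (F : forall i, T i -> R) :
  \prod_i \sum_(j : T i) F i j =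
    \sum_(u : {dffun forall i, T i}) \prod_i F i (u i).
Proof.
(* The type of the inner index varies with i, so the sums pass to the tagged union, where
   distributivity is available, and return through [fprod]. *)
under eq_bigr => i _ do rewrite big_tag.
rewrite bigA_distr_big_dep.
pose P i := [ffun j => F i j].
have PE i : F i = P i by apply/funext => j; rewrite ffunE.
transitivity (\sum_(t : fprod T) \prod_i P i (t i)).
  rewrite big_fprod; apply: eq_bigr => u _; apply: eq_bigr => i _.
  by rewrite -PE.
rewrite (reindex (@fprod_of_dffun I T)); last exact/onW_bij/fprod_of_dffun_bij.
by apply: eq_bigr => u _; apply: eq_bigr => i _; rewrite fprodE ffunE.
Qed.

(** When a_0 = 1 this is the infinite product, over all indeterminates x, of the one-variable series
    with coefficients a_k. *)
Definition multiplicative (a : nat -> rat) : series :=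
  fun m => \prod_(x <- finsupp m) a (m x).

Lemma multiplicativeE (a : nat -> rat) (m m' : monomial) : a 0%N = 1 ->
  {subset finsupp m <= finsupp m'} ->
  multiplicative a m = \prod_(x <- finsupp m') a (m x).
Proof.
move=> a0 /fsubsetP s; rewrite /multiplicative (big_fset_incl _ s) //=.
by move=> x _ xm; rewrite fsfun_dflt.
Qed.

(** A divisor of m is an independent choice of one exponent per indeterminate, so the sum over
    divisors factors into one-variable Cauchy products. *)
Lemma multiplicativeM (a b : nat -> rat) : a 0%N = 1 -> b 0%N = 1 ->
  multiplicative a * multiplicative b =
  multiplicative (fun k => \sum_(i < k.+1) a i * b (k - i)%N).
Proof.
move=> a0 b0; apply/funext => m; rewrite mul_seriesE [RHS]/multiplicative.
rewrite big_seq_fsetE /= prod_sum_dffun.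
rewrite /divisors big_map big_enum /=; apply: eq_bigr => u _.
set d := mkcmonom _.
have dE (x : finsupp m) : d (val x) = u x.
  by rewrite cmE fsfun_ffun; case: insubP => [y _ /val_inj -> //|]; rewrite (valP x).
have le x : (d x <= m x)%N.
  case: (finsuppP m x) => [|xm]; last by rewrite (dE [` xm]%fset) -ltnS ltn_ord.
  by rewrite cmE fsfun_ffun => xm; rewrite insubN.
rewrite !(@multiplicativeE _ _ m) //.
- rewrite -big_split big_seq_fsetE /=; apply: eq_bigr => x _.
  by rewrite divcmE dE.
- by move=> x; rewrite !mem_finsupp divcmE; apply: contraNneq => ->.
- move=> x; rewrite !mem_finsupp; apply: contraNneq => e.
  by have := le x; rewrite e leqn0.
Qed.

(** The coefficients of 1 + x and, next, of 1 - x: their multiplicative series are the sums of all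
    E^+_d and of all E_d. *)
Definition eplus_coef (k : nat) : rat := (k <= 1)%:R.
Definition eminus_coef (k : nat) : rat := (-1) ^+ k * (k <= 1)%:R.

Lemma multiplicative_eplus m : multiplicative eplus_coef m = (square_free m)%:R.
Proof.
rewrite /multiplicative big_seq_fsetE /= /square_free.
case: forallP => [h|/forallP]; first by rewrite big1 // => x _; rewrite /eplus_coef h.
rewrite negb_forall => /existsP[x /negbTE h].
by rewrite (bigD1 x) //= /eplus_coef h mul0r.
Qed.

Lemma multiplicative_eminus m :
  multiplicative eminus_coef m = (-1) ^+ #|` finsupp m| * (square_free m)%:R.
Proof.
rewrite -multiplicative_eplus /multiplicative.
transitivity (\prod_(x <- finsupp m) (-1 * eplus_coef (m x))).
  rewrite big_seq [RHS]big_seq; apply: eq_bigr => x.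
  rewrite mem_finsupp /eplus_coef /eminus_coef.
  by case: (m x) => [//|[//|k]] _; rewrite !mulr0.
rewrite big_split /=; congr (_ * _).
by rewrite big_seq_fsetE /= prodr_const; congr (_ ^+ _); rewrite cardfE.
Qed.

Lemma multiplicative_prod :
  multiplicative eplus_coef * multiplicative eminus_coef =
  subst_pow 2 (multiplicative eminus_coef).
Proof.
rewrite multiplicativeM //; apply/funext => m.
(* [c] is the coefficient sequence of (1 + x)(1 - x) = 1 - x^2. *)
set c := fun k : nat => _.
have c3 k : c k.+3 = 0.
  rewrite /c big1 // => -[i ilt] _ /=; rewrite /eplus_coef /eminus_coef.
  case: (leqP i 1) => hi; rewrite ?mul0r ?mul1r //.
  by rewrite (_ : (k.+3 - i <= 1)%N = false) ?mulr0 //; lia.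
have c0 : c 0%N = 1 by rewrite /c !big_ord_recr big_ord0.
have c1 : c 1%N = 0 by rewrite /c !big_ord_recr big_ord0.
have c2 : c 2%N = -1 by rewrite /c !big_ord_recr big_ord0.
rewrite /subst_pow; case: ifP => [/forallP h|/negbT].
  rewrite [RHS](@multiplicativeE _ _ m) // => [|x]; last first.
    rewrite !mem_finsupp cmE fsfun_fun.
    by rewrite -mem_finsupp; case: (x \in finsupp m).
  rewrite /multiplicative big_seq [RHS]big_seq; apply: eq_bigr => x xm.
  rewrite cmE fsfun_fun xm; have /dvdnP[q e] := h [` xm]%fset.
  rewrite /= in e; rewrite e mulnK //.
  by case: q {e} => [|[|q]]; rewrite ?c0 ?c2 ?c3 // /eminus_coef mulr0.
(* Some exponent is odd, and [c] vanishes at every odd number. *)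
rewrite negb_forall => /existsP[x]; rewrite /multiplicative big_seq_fsetE /=.
move=> xm; rewrite (bigD1 x) //=.
suff -> : c (m (fsval x)) = 0 by rewrite mul0r.
by case: (m _) xm => [|[|[|k]]].
Qed.

(** * Weighted degree and homogeneous parts *)

Lemma wdegE (m : monomial) (S : {fset indet}) : {subset finsupp m <= S} ->
  wdeg m = (\sum_(x <- S) m x * x.1.+1)%N.
Proof.
move=> /fsubsetP s; rewrite /wdeg (big_fset_incl _ s) //.
by move=> x _ xm; rewrite fsfun_dflt.
Qed.

Lemma wdegM (m m' : monomial) : wdeg (mulcm m m') = (wdeg m + wdeg m')%N.
Proof.
rewrite (@wdegE m (finsupp (mulcm m m'))) ?(@wdegE m' (finsupp (mulcm m m'))).
- by rewrite -big_split; apply: eq_bigr => x _; rewrite mulcmE mulnDl.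
- by move=> x; rewrite !mem_finsupp mulcmE -!lt0n => h; rewrite ltn_addl.
- by move=> x; rewrite !mem_finsupp mulcmE -!lt0n => h; rewrite ltn_addr.
Qed.

Lemma wdeg_pow r (m : monomial) : wdeg (pow_monomial r m) = (wdeg m * r)%N.
Proof.
rewrite (@wdegE _ (finsupp m)) => [|x].
  by rewrite /wdeg big_distrl; apply: eq_bigr => x _; rewrite pow_monomialE mulnAC.
by rewrite !mem_finsupp pow_monomialE muln_eq0 negb_or => /andP[].
Qed.

Lemma EplusE d m : Eplus d m = multiplicative eplus_coef m * (wdeg m == d)%:R.
Proof.
rewrite multiplicative_eplus /Eplus.
by case: square_free; case: eqP; rewrite ?mulr0 ?mulr1.
Qed.

Lemma EminusE d m : Eminus d m = multiplicative eminus_coef m * (wdeg m == d)%:R.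
Proof.
rewrite multiplicative_eminus /Eminus.
by case: square_free; case: eqP; rewrite ?mulr0 ?mulr1.
Qed.

(* (1 + x) (1 - x) = 1 - x ^ 2, multiplied over all indeterminates. *)
Lemma sum_Eplus_Eminus l : \sum_(i < l.+1) Eplus i * Eminus (l - i)
  = if odd l then 0 else subst_pow 2 (Eminus l./2).
Proof.
apply/funext => m; rewrite sum_seriesE.
(* The sum over i is the part of degree l of the full product: a divisor d of m contributes only to
   the term i = [wdeg d]. *)
transitivity ((multiplicative eplus_coef * multiplicative eminus_coef) m
    * (wdeg m == l)%:R).
  rewrite mul_seriesE big_distrl /= exchange_big /= big_seq [RHS]big_seq.
  apply: eq_bigr => d /mem_divisors dm.
  have := wdegM d (divcm m d); rewrite dm => ->.
  set a := wdeg d; set b := wdeg _.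
  case: eqP => [<-|ne]; last first.
    rewrite mulr0 big1 // => i _; rewrite EplusE EminusE.
    rewrite mulrACA -natrM mulnb; case: andP => [[/eqP ia /eqP ib]|_]; last by rewrite mulr0.
    by case: ne; rewrite /a /b ia ib subnKC // -ltnS.
  have alt : (a < (a + b).+1)%N by rewrite ltnS leq_addr.
  rewrite (bigD1 (Ordinal alt)) //= big1 ?addr0.
    by rewrite EplusE EminusE -/a -/b eqxx addKn eqxx !mulr1.
  move=> i ine; rewrite EplusE -/a.
  suff -> : (a == i) = false by rewrite mulr0 mul0r.
  by apply: contraNF ine => /eqP e; apply/eqP/val_inj.
rewrite multiplicative_prod; case: (subst_powP 2 m) => [[m' ->]|h]; last first.
  by rewrite h mul0r; case: ifP; rewrite ?h.
rewrite subst_powE // wdeg_pow; case: ifP => [l2|l2].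
  rewrite (_ : (_ == _) = false) ?mulr0 //.
  by apply: contraTF l2 => /eqP <-; rewrite oddM andbF.
by rewrite subst_powE // EminusE; congr (_ * (nat_of_bool _)%:R); lia.
Qed.

Lemma wdeg_eq0 m : (wdeg m == 0%N) = (m == onecm indet).
Proof.
apply/eqP/eqP => [h|->]; last first.
  by rewrite (@wdegE _ fset0) ?big_seq_fset0 // => x; rewrite mem_finsupp onecmE.
apply: cmonomP => x; rewrite onecmE; apply/eqP; apply: contraTT isT => mx.
have xm : x \in finsupp m by rewrite mem_finsupp.
move/eqP: h; rewrite /wdeg big_seq_fsetE /= (bigD1 [` xm]%fset) //= addn_eq0.
by rewrite muln_eq0 (negbTE mx).
Qed.

Lemma multiplicative_onecm a : multiplicative a (onecm indet) = 1.
Proof.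
rewrite /multiplicative (_ : finsupp _ = fset0) ?big_seq_fset0 //.
by apply/fsetP => x; rewrite mem_finsupp onecmE.
Qed.

Lemma Eplus0 : Eplus 0 = 1.
Proof.
apply/funext => m; rewrite EplusE wdeg_eq0 series1E; case: eqP => [->|_].
  by rewrite multiplicative_onecm mulr1.
by rewrite mulr0.
Qed.

Lemma Eminus0 : Eminus 0 = 1.
Proof.
apply/funext => m; rewrite EminusE wdeg_eq0 series1E; case: eqP => [->|_].
  by rewrite multiplicative_onecm mulr1.
by rewrite mulr0.
Qed.

(** * The recursion over marking levels *)

Lemma sum_dvd_succ (p l : nat) (H : nat -> series) : (0 < p)%N ->
  \sum_(0 <= i < p * l | (p %| i.+1)%N) H (i.+1 %/ p)%N =
  \sum_(0 <= c < l) H c.+1.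
Proof.
case: p => // p _; elim: l => [|l IH]; first by rewrite muln0 !big_geq.
rewrite big_nat_recr //= -IH mulnS addnC.
rewrite (@big_cat_nat _ _ _ (p.+1 * l)) ?leq_addr //=; congr (_ + _).
(* Among the indices of this last stretch, only the final one has a successor divisible by the
   step. *)
rewrite -{1}[(p.+1 * l)%N]add0n big_addn addKn big_mkcond big_nat_recr //=.
rewrite big_nat big1 ?add0r => [|i ip]; last first.
  case: ifP => //; rewrite -addSn dvdn_addl ?dvdn_mulr //.
  by move/dvdn_leq => /(_ isT); rewrite ltnNge (andP ip).2.
by rewrite -addSn dvdn_addl ?dvdn_mulr // dvdnn -mulnS mulKn.
Qed.

Section LevelRecursion.
Variable q : nat.
Hypothesis q_gt0 : (0 < q)%N.

(* The signed sum over the tilings of a row of length l in the q-th tensor factor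
   by bricks of marking at least k. *)
Definition Elevel (k l : nat) : series :=
  if (2 ^ k %| l)%N then subst_pow (2 ^ k * q) (Eminus (l %/ 2 ^ k)) else 0.

Lemma Elevel_rec k l : (0 < l)%N ->
  Elevel k l = Elevel k.+1 l +
    \sum_(0 <= i < l | (2 ^ k %| i.+1)%N)
       - subst_pow (2 ^ k * q) (Eplus (i.+1 %/ 2 ^ k)) * Elevel k (l - i.+1).
Proof.
have p0 : (0 < 2 ^ k)%N by rewrite expn_gt0.
have pq0 : (0 < 2 ^ k * q)%N by rewrite muln_gt0 p0.
move=> l0; rewrite /Elevel; case: (boolP (2 ^ k %| l)%N) => [/dvdnP[c lc]|ndvd]; last first.
  rewrite ifN ?add0r; last first.
    by apply: contra ndvd; apply: dvdn_trans; rewrite expnS dvdn_mull.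
  rewrite big_nat_cond big1 // => i /andP[/andP[_ il] di].
  by rewrite ifN ?mulr0 // dvdn_subl.
rewrite mulnC in lc; rewrite lc mulKn // expnSr.
rewrite dvdn_pmul2l // dvdn2 divnMl // divn2.
have -> : (if ~~ odd c then subst_pow (2 ^ k * 2 * q) (Eminus c./2) else 0) =
    subst_pow (2 ^ k * q) (if odd c then 0 else subst_pow 2 (Eminus c./2)).
  case: (odd c); rewrite /= ?subst_pow0 // subst_pow_comp //.
  by congr (subst_pow _ _); lia.
rewrite -sum_Eplus_Eminus big_ord_recl Eplus0 mul1r subn0 subst_powD.
pose H i := - subst_pow (2 ^ k * q) (Eplus i) * subst_pow (2 ^ k * q) (Eminus (c - i)).
transitivity (subst_pow (2 ^ k * q) (Eminus c) + \sum_(0 <= i < c) - H i.+1 +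
    \sum_(0 <= i < c) H i.+1).
  by rewrite sumrN subrK.
congr (_ + _ + _).
  rewrite big_mkord subst_pow_sum; apply: eq_bigr => i _.
  by rewrite /H mulNr opprK subst_powM.
rewrite -(sum_dvd_succ _ H p0); apply: eq_bigr => i /dvdnP[j ij].
by rewrite ij [(j * _)%N]mulnC -mulnBr dvdn_mulr // !mulKn.
Qed.

End LevelRecursion.

(** * Tilings of sets of cells by marked bricks *)

Lemma big_ord_interval (R : Type) (idx : R) (op : Monoid.law idx) (n : nat)
    (F : nat -> R) (P : pred nat) (a b : nat) : (b <= n)%N ->
  \big[op/idx]_(j < n | (a <= j < b)%N && P j) F j =
  \big[op/idx]_(0 <= i < b - a | P (i + a)%N) F (i + a)%N.
Proof.
move=> bn; rewrite -(big_mkord (fun j => (a <= j < b)%N && P j) F).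
rewrite -[RHS](big_addn 0 b a P F) add0n [RHS](big_nat_widen _ _ _ _ _ bn).
rewrite (big_nat_widenl _ _ _ _ _ (leq0n a)) //.
by apply: eq_bigl => j; rewrite [RHS]andbC andbC andbCA.
Qed.

Section Tilings.
Variable n : nat.
Implicit Types (D : {set cell n}) (T : {set marked_brick n}) (r : 'I_n * 'I_n).
Implicit Types (b : marked_brick n) (c : cell n).

(** These are the conditions on a dyadic tabloid other than its content, for any set of cells, so
    that rows and initial pieces of rows can be removed. *)
Definition tiling D T : bool :=
  [&& [forall b in T, is_brick b],
      [forall b in T, forall b' in T,
         (b != b') ==> [disjoint brick_cells b & brick_cells b']],
      \bigcup_(b in T) brick_cells b == D
    & [forall b in T, forall b' in T,
         same_row b b' && (brick_mark b < brick_mark b')%N ==> right_of b' b]].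

Definition tiling_spec D T : Prop :=
  [/\ forall b, b \in T -> is_brick b,
      forall b b' c, b \in T -> b' \in T ->
        c \in brick_cells b -> c \in brick_cells b' -> b = b',
      forall c, c \in D <-> exists2 b, b \in T & c \in brick_cells b
    & forall b b', b \in T -> b' \in T -> b.1.1 = b'.1.1 -> (b.2 < b'.2)%N ->
        forall j j' : 'I_n, j \in b.1.2 -> j' \in b'.1.2 -> (j < j')%N].

Lemma tilingP D T : reflect (tiling_spec D T) (tiling D T).
Proof.
apply: (iffP and4P) => -[H1 H2 H3 H4]; split.
- by move=> b bT; apply: (implyP (forallP H1 b)).
- move=> b b' c bT b'T cb cb'; apply/eqP; apply: contraTT cb' => bb'.
  have := implyP (forallP (implyP (forallP H2 b) bT) b') b'T.
  by rewrite bb' /= => /disjointFr ->.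
- move=> c; rewrite -(eqP H3); split=> [/bigcupP[b bT cb]|[b bT cb]]; first by exists b.
  by apply/bigcupP; exists b.
- move=> b b' bT b'T rr mm j j' jb jb'.
  have := implyP (forallP (implyP (forallP H4 b) bT) b') b'T.
  rewrite /same_row /brick_factor /brick_row rr !eqxx /= => /implyP/(_ mm).
  by move=> /forallP/(_ j)/implyP/(_ jb)/forallP/(_ j')/implyP/(_ jb').
- by apply/forallP => b; apply/implyP/H1.
- apply/forallP => b; apply/implyP => bT; apply/forallP => b'; apply/implyP => b'T.
  apply/implyP => /eqP bb'; apply/pred0P => c /=; apply/negbTE/negP => /andP[cb cb'].
  by apply: bb'; apply: H2 cb cb'.
- apply/eqP/setP => c; apply/bigcupP/idP => [h|/H3 //]; exact/H3.
- apply/forallP => b; apply/implyP => bT; apply/forallP => b'; apply/implyP => b'T.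
  apply/implyP => /andP[/andP[/eqP r1 /eqP r2] mm].
  apply/forallP => j; apply/implyP => jb; apply/forallP => j'; apply/implyP => jb'.
  apply: (H4 b b') => //; move: r1 r2; rewrite /brick_factor /brick_row.
  by case: (b.1.1) (b'.1.1) => [? ?] [? ?] /= -> ->.
Qed.

Lemma mem_brick_cells b c : (c \in brick_cells b) = (c.1 == b.1.1) && (c.2 \in b.1.2).
Proof. by rewrite inE /brick_factor /brick_row /brick_cols andbA. Qed.

Lemma brick_nonempty b : is_brick b -> exists j : 'I_n, j \in b.1.2.
Proof.
case/andP => /existsP[a /existsP[z /andP[az /eqP e]]] _; exists a.
by move: e; rewrite /brick_cols => ->; rewrite inE leqnn.
Qed.

(** Once a k-brick has been peeled off the left end of row r, the rest of the row admits only
    markings at least k; the other rows stay unrestricted. *)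
Definition tiling_from r (k : nat) D T : bool :=
  tiling D T && [forall b in T, (b.1.1 == r) ==> (k <= b.2)%N].

Definition segment r (s d : nat) : {set cell n} :=
  [set c : cell n | (c.1 == r) && (s <= c.2 < d)%N].

(** The last column z is included, so the length is z + 1 - s and the next brick starts in column z
    + 1. *)
Definition interval_brick r (s : nat) (z k : 'I_n) : marked_brick n :=
  (r, [set j : 'I_n | s <= j <= z]%N, k).

Lemma interval_brick_length r s (z k : 'I_n) : (s <= z)%N ->
  brick_length (interval_brick r s z k) = (z.+1 - s)%N.
Proof.
move=> sz; rewrite /brick_length /brick_cols /= -sum1_card.
transitivity (\sum_(j < n | (s <= j < z.+1) && predT (j : nat)) 1)%N.
  by apply: eq_bigl => j; rewrite inE ltnS andbT.
by rewrite (@big_ord_interval _ _ addn n (fun=> 1%N) predT) // sum_nat_const_nat subn0 muln1.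
Qed.

Variables (R : comNzRingType) (g : nat * nat -> R).

Definition tiling_sum r k D : R :=
  \sum_(T | tiling_from r k D T) \prod_(b in T) g (brick_block b).

(** * Peeling the leftmost brick off row r, with [D'] the cells of other rows *)

Section Peel.
Variables (r : 'I_n * 'I_n) (s d : nat) (D' : {set cell n}).
Hypotheses (sd : (s < d)%N) (dn : (d <= n)%N).
Hypothesis D'r : forall c, c \in D' -> c.1 != r.
Variable k : 'I_n.

Let first_brick (z : 'I_n) := interval_brick r s z k.
Let good (z : 'I_n) := (s <= z < d)%N && (2 ^ k %| z.+1 - s)%N.

Let s_ord : 'I_n := Ordinal (leq_trans sd dn).

Lemma mem_segmentU (x : nat) c : (c \in segment r x d :|: D') =
  if c.1 == r then (x <= c.2 < d)%N else c \in D'.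
Proof.
rewrite !inE; case: eqP => //= e.
by case: (boolP (c \in D')) => [/D'r|_]; rewrite ?e ?eqxx // orbF.
Qed.

Lemma first_brick_is_brick z : good z -> is_brick (first_brick z).
Proof.
case/andP => /andP[sz zd] dv; apply/andP; split; last first.
  by rewrite interval_brick_length.
by apply/existsP; exists s_ord; apply/existsP; exists z; rewrite sz /=.
Qed.

Lemma mem_first_brick z c :
  (c \in brick_cells (first_brick z)) = (c.1 == r) && (s <= c.2 <= z)%N.
Proof. by rewrite mem_brick_cells /first_brick /interval_brick /= inE. Qed.

(** Adding the first brick respects the order of markings: it lies to the left of all other bricks
    of row r, and none of these has a marking below k. *)
Lemma tiling_from_peel z T : good z ->
  tiling_from r k (segment r s d :|: D') (first_brick z |: T) &&
    (first_brick z \notin T) =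
  tiling_from r k (segment r z.+1 d :|: D') T.
Proof.
move=> gz; have /andP[/andP[sz zd] dv] := gz; set B := first_brick z.
have DE c : (c \in segment r z.+1 d :|: D') =
    (c \in segment r s d :|: D') && (c \notin brick_cells B).
  rewrite !mem_segmentU mem_first_brick; case: eqP => _ /=; last by rewrite andbT.
  by lia.
have Bs c : c \in brick_cells B -> c \in segment r s d :|: D'.
  rewrite mem_segmentU mem_first_brick => /andP[-> h]; lia.
apply/andP/idP => [[/andP[/tilingP[H1 H2 H3 H4] /forallP H5] BT]|].
  have TB b : b \in T -> b \in B |: T by move=> bT; rewrite inE bT orbT.
  apply/andP; split; last by apply/forallP => b; apply/implyP => /TB; apply/implyP/H5.
  apply/tilingP; split.
  - by move=> b /TB; apply: H1.
  - by move=> b b' c /TB bT /TB b'T; apply: H2.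
  - move=> c; rewrite DE; split.
      case/andP => /H3[b]; rewrite in_setU1 => /orP[|bT cb _]; last by exists b.
      by move/eqP=> -> ->.
    case=> b bT cb; rewrite (iffRL (H3 c)) /=; last by exists b; rewrite ?TB.
    by apply: contra BT => cB; rewrite -(H2 b B c (TB b bT) (setU11 B T) cb cB).
  - by move=> b b' /TB bT /TB b'T; apply: H4.
case/andP=> /tilingP[H1 H2 H3 H4] /forallP H5.
have Tcell b c : b \in T -> c \in brick_cells b -> c \notin brick_cells B.
  move=> bT cb; have : c \in segment r z.+1 d :|: D' by apply/H3; exists b.
  by rewrite DE => /andP[].
have BT : B \notin T.
  apply/negP => BT; have := @Tcell B (r, s_ord) BT.
  by rewrite mem_first_brick /= eqxx leqnn sz => /(_ isT).
split=> //; apply/andP; split; last first.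
  apply/forallP => b; apply/implyP; rewrite in_setU1 => /orP[/eqP ->|bT].
    by rewrite /= leqnn implybT.
  exact: (implyP (H5 b)).
apply/tilingP; split.
- by move=> b; rewrite in_setU1 => /orP[/eqP ->|/H1 //]; apply: first_brick_is_brick.
- move=> b b' c; rewrite !in_setU1.
  move=> /orP[/eqP ->|bT] /orP[/eqP ->|b'T] // cb cb'.
  + by have := Tcell _ _ b'T cb'; rewrite cb.
  + by have := Tcell _ _ bT cb; rewrite cb'.
  + exact: H2 cb cb'.
- move=> c; split.
    move=> cD; case: (boolP (c \in brick_cells B)) => cB.
      by exists B; rewrite // in_setU1 eqxx.
    have /H3[b bT cb] : c \in segment r z.+1 d :|: D' by rewrite DE cD.
    by exists b; rewrite // in_setU1 bT orbT.
  case=> b; rewrite in_setU1 => /orP[/eqP ->|bT cb]; first exact: Bs.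
  have : c \in segment r z.+1 d :|: D' by apply/H3; exists b.
  by rewrite DE => /andP[].
- have rowT b : b \in T -> b.1.1 = r -> forall j : 'I_n, j \in b.1.2 -> (z < j)%N.
    move=> bT br j jb.
    have : (r, j) \in segment r z.+1 d :|: D'.
      by apply/H3; exists b; rewrite // mem_brick_cells /= br eqxx.
    by rewrite mem_segmentU eqxx /= => /andP[].
  move=> b b'; rewrite !in_setU1 => /orP[/eqP ->|bT] /orP[/eqP ->|b'T] /=.
  + by rewrite ltnn.
  + move=> e _ j j'; rewrite inE => /andP[_ jz] /rowT; rewrite -e => h.
    by apply: leq_ltn_trans jz (h b'T erefl).
  + move=> e; have := implyP (H5 b) bT; rewrite e eqxx /= leqNgt.
    by move=> /negbTE ->.
  + exact: H4.
Qed.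

(** Suppose row r contains a k-brick. The brick covering column s cannot have a larger marking, as
    it would then lie to the right of that k-brick; so it is itself a k-brick, and it starts at
    s. *)
Lemma tiling_from_next T :
  tiling_from r k.+1 (segment r s d :|: D') T =
  tiling_from r k (segment r s d :|: D') T && [forall z, good z ==> (first_brick z \notin T)].
Proof.
apply/idP/idP => [/andP[HT /forallP H5]|/andP[/andP[HT /forallP H5] /forallP H6]];
  last have /tilingP[H1 H2 H3 H4] := HT.
  rewrite /tiling_from HT /=; apply/andP; split; apply/forallP => b.
    by apply/implyP => bT; apply/implyP => br; apply/ltnW/(implyP (implyP (H5 b) bT)).
  by apply/implyP => _; apply/negP => bT; have := implyP (H5 _) bT; rewrite /= eqxx ltnn.
rewrite /tiling_from HT /=; apply/forallP => b0; apply/implyP => b0T.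
apply/implyP => /eqP b0r; have := implyP (H5 b0) b0T; rewrite b0r eqxx /= leq_eqVlt.
case: eqP => //= kb0 _; exfalso.
have seg_r b (j : 'I_n) : b \in T -> b.1.1 = r -> j \in b.1.2 -> (s <= j < d)%N.
  move=> bT br jb; have : (r, j) \in segment r s d :|: D'.
    by apply/H3; exists b; rewrite // mem_brick_cells /= br eqxx.
  by rewrite mem_segmentU eqxx.
(* [b0] is some k-brick of row r; [b] is the brick covering the first cell of the segment. *)
have [b bT] : exists2 b, b \in T & (r, s_ord) \in brick_cells b.
  by apply/H3; rewrite mem_segmentU eqxx /= leqnn.
rewrite mem_brick_cells /= => /andP[/eqP/esym br sb].
have bk : b.2 = k.
  apply/val_inj/eqP; rewrite eqn_leq (implyP (implyP (H5 b) bT)) ?br // andbT leqNgt.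
  apply/negP => kb; have [j jb0] := brick_nonempty (H1 _ b0T).
  have := H4 b0 b b0T bT (etrans b0r (esym br)).
  rewrite -kb0 => /(_ kb j s_ord jb0 sb); rewrite ltnNge.
  by case/andP: (seg_r b0 j b0T b0r jb0) => ->.
have /andP[/existsP[a /existsP[z /andP[az /eqP be]]] dv] := H1 b bT.
rewrite /brick_cols in be.
have az_in j : (j \in b.1.2) = (a <= j <= z)%N by rewrite be inE.
(* The brick [b] covers column s, and row r has no cell further to the left. *)
have as_ : a = s :> nat.
  apply/eqP; rewrite eqn_leq; move: sb; rewrite az_in => /andP[-> _] /=.
  have ab : a \in b.1.2 by rewrite az_in leqnn.
  by case/andP: (seg_r b a bT br ab).
have bE : b = first_brick z.
  rewrite /first_brick /interval_brick -as_ -be -br -bk.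
  by case: (b) => [[? ?] ?].
have gz : good z.
  apply/andP; split; first by apply: (seg_r b) => //; rewrite az_in az /=.
  have szz : (s <= z)%N by rewrite -as_.
  by rewrite -(interval_brick_length r k szz) -/(first_brick z) -bE -bk.
by have := implyP (H6 z) gz; rewrite -bE bT.
Qed.

Lemma first_brick_uniq T z z' : tiling_from r k (segment r s d :|: D') T ->
  good z -> good z' -> first_brick z \in T -> first_brick z' \in T -> z = z'.
Proof.
move=> /andP[/tilingP[_ H2 _ _] _] /andP[/andP[sz _] _] /andP[/andP[sz' _] _] zT z'T.
have e : first_brick z = first_brick z'.
  by apply: (H2 _ _ (r, s_ord)); rewrite // mem_first_brick /= eqxx leqnn.
have zz' (j : 'I_n) : (s <= j <= z)%N = (s <= j <= z')%N.
  by have := congr1 (fun b => j \in brick_cols b) e; rewrite /= !inE.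
apply/val_inj/eqP; rewrite eqn_leq.
by have := zz' z; have := zz' z'; rewrite !leqnn sz sz' /= => -> <-.
Qed.

Lemma tiling_sum_peel :
  tiling_sum r k (segment r s d :|: D') = tiling_sum r k.+1 (segment r s d :|: D') +
    \sum_(z | good z) g ((z.+1 - s) %/ 2 ^ k, 2 ^ k * r.1.+1)%N *
       tiling_sum r k (segment r z.+1 d :|: D').
Proof.
set Ds := segment r s d :|: D'; rewrite {1}/tiling_sum.
pose F T := \prod_(b in T) g (brick_block b).
rewrite (bigID [pred T : {set _} | [forall z, good z ==> (first_brick z \notin T)]]) /=.
congr (_ + _); first by apply: eq_bigl => T; rewrite tiling_from_next.
(* A tiling opened by a k-brick has exactly one such z; for the other tilings the inner sum is
   empty. *)
transitivity (\sum_(T | tiling_from r k Ds T)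
    \sum_(z | good z && (first_brick z \in T)) F T).
  rewrite [RHS](bigID [pred T : {set _} | [forall z, good z ==> (first_brick z \notin T)]]) /=.
  rewrite [X in _ = X + _]big1 ?add0r => [|T /andP[_ /forallP h]]; last first.
    by rewrite big1 // => z /andP[gz zT]; have := h z; rewrite gz zT.
  apply: eq_bigr => T /andP[tT]; rewrite negb_forall => /existsP[z].
  rewrite negb_imply negbK => /andP[gz zT].
  rewrite (big_pred1 z) // => z'; apply/andP/eqP => [[gz' z'T]|-> //].
  exact: first_brick_uniq z'T zT.
rewrite (exchange_big_dep good) /=; last by move=> T z _ /andP[].
apply: eq_bigr => z gz; rewrite /tiling_sum big_distrr /=.
(* Removing the first brick is inverse to adding it. *)
rewrite (reindex_onto (fun T => first_brick z |: T) (fun T => T :\ first_brick z)) /=; last first.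
  by move=> T /andP[_ /andP[_ zT]]; apply: setD1K.
have blk : brick_block (first_brick z) = ((z.+1 - s) %/ 2 ^ k, 2 ^ k * r.1.+1)%N.
  by rewrite /brick_block interval_brick_length //; case/andP: gz => /andP[].
have zP T : ((first_brick z |: T) :\ first_brick z == T) = (first_brick z \notin T).
  apply/eqP/idP => [<-|]; first by rewrite in_setD1 eqxx.
  exact: setU1K.
apply: eq_big => [T|T].
  by rewrite setU11 gz !andbT zP tiling_from_peel.
by rewrite zP => /andP[_ zT]; rewrite /F big_setU1 //= blk.
Qed.

End Peel.

(** * The signed tiling sum of one row *)

Lemma tiling_from_segment0 r k s (D' : {set cell n}) T :
  (forall c, c \in D' -> c.1 != r) ->
  tiling_from r k (segment r s s :|: D') T = tiling D' T.
Proof.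
move=> D'r; have -> : segment r s s :|: D' = D'.
  apply/setP => c; rewrite !inE; by case: (ltnP c.2 s) => _; rewrite ?andbF.
apply: andb_idr => /tilingP[H1 _ H3 _]; apply/forallP => b; apply/implyP => bT.
apply/implyP => /eqP br; have [j jb] := brick_nonempty (H1 b bT).
have /D'r : (b.1.1, j) \in D' by apply/H3; exists b; rewrite // mem_brick_cells eqxx.
by rewrite br eqxx.
Qed.

(** Markings are ordinals below n, so no brick is left to cover the first cell of the segment. *)
Lemma tiling_sum_mark_big r s d (D' : {set cell n}) : (s < d)%N -> (d <= n)%N ->
  (forall c, c \in D' -> c.1 != r) -> tiling_sum r n (segment r s d :|: D') = 0.
Proof.
move=> sd dn D'r; rewrite /tiling_sum big1 // => T /andP[/tilingP[_ _ H3 _] /forallP H].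
pose s' : 'I_n := Ordinal (leq_trans sd dn).
have /H3[b bT] : (r, s') \in segment r s d :|: D' by rewrite !inE /= eqxx leqnn sd.
rewrite mem_brick_cells => /andP[/eqP br _].
by have := implyP (H b) bT; rewrite -br eqxx /= leqNgt ltn_ord.
Qed.

End Tilings.

(** [tiling_sum_peel] and [Elevel_rec] are the same recursion. Each brick carries the weight
    -E^+_d(x^r) of its block d^r, so one row contributes the factor [Elevel] and the other rows are
    untouched. *)
Lemma tiling_sum_row n (r : 'I_n * 'I_n) (k s d : nat) (D' : {set cell n}) :
  let g (p : nat * nat) := - subst_pow p.2 (Eplus p.1) in
  (forall c, c \in D' -> c.1 != r) -> (k <= n)%N -> (s <= d)%N -> (d <= n)%N ->
  tiling_sum g r k (segment r s d :|: D') =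
    Elevel r.1.+1 k (d - s) * \sum_(T | tiling D' T) \prod_(b in T) g (brick_block b).
Proof.
move=> g D'r kn sd dn; set W := \sum_(T | _) _.
have base k' : tiling_sum g r k' (segment r d d :|: D') = Elevel r.1.+1 k' 0 * W.
  rewrite /Elevel dvdn0 div0n Eminus0 subst_pow1 ?mul1r; last by rewrite muln_gt0 expn_gt0.
  by apply: eq_bigl => T; apply: tiling_from_segment0.
(* Downward induction on k from n, with strong induction on the remaining length of the row inside
   it. *)
move eqj: (n - k)%N => j; elim: j k kn eqj s sd => [|j IHj] k kn eqj s.
  have {eqj} -> : k = n by lia.
  rewrite leq_eqVlt => /orP[/eqP ->|sd]; first by rewrite subnn base.
  (* At k = n both sides vanish, because 0 < d - s <= n < 2^n. *)
  rewrite tiling_sum_mark_big // /Elevel ifN ?mul0r //.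
  apply/negP => /dvdn_leq; rewrite subn_gt0 => /(_ sd); rewrite leqNgt.
  by rewrite (leq_ltn_trans _ (ltn_expl n (ltnSn 1))) // (leq_trans (leq_subr _ _)).
have kn' : (k < n)%N by lia.
move eql: (d - s)%N => l; elim/ltn_ind: l s eql => l IHl s eql.
rewrite leq_eqVlt => /orP[/eqP sd|sd].
  by move: eql; rewrite sd subnn => <-; rewrite base.
rewrite (tiling_sum_peel g sd dn D'r (Ordinal kn')) /= IHj //; last 2 first.
- lia.
- exact: ltnW.
have l0 : (0 < l)%N by rewrite -eql subn_gt0.
rewrite eql [in RHS]Elevel_rec // mulrDl; congr (_ + _).
pose F (i : nat) : series := - subst_pow (2 ^ k * r.1.+1) (Eplus ((i.+1 - s) %/ 2 ^ k)) *
  (Elevel r.1.+1 k (d - i.+1) * W).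
rewrite (eq_bigr (fun z : 'I_n => F z)) => [|z /andP[/andP[sz zd] _]]; last first.
  by rewrite (IHl (d - z.+1)%N) //; lia.
rewrite (@big_ord_interval _ _ _ n F (fun i => 2 ^ k %| i.+1 - s)%N) // mulr_suml eql.
apply: eq_big => [i|i _]; first by rewrite -addSn addnK.
by rewrite /F -addSn addnK addnC subnDA eql mulrA.
Qed.

(** * Types as multisets of blocks *)

Section Types.
Local Open Scope nat_scope.
Variable n : nat.
Implicit Types (t : Typ n) (f : nat -> seq nat) (l : seq nat).

Definition block_seq f l : seq (nat * nat) := [seq (d, i.+1) | i <- l, d <- f i].

Lemma blocksE t : blocks t = block_seq (nth [::] t) (iota 0 n).
Proof. by []. Qed.

Lemma filter_block_seq f l i : uniq l ->
  [seq p.1 | p <- block_seq f l & p.2 == i.+1] = if i \in l then f i else [::].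
Proof.
elim: l => //= j l IH /andP[jl /IH e]; rewrite /block_seq /=.
rewrite filter_cat map_cat e filter_map -map_comp inE /=.
rewrite (eq_filter (a2 := fun=> j == i)) => [|d]; last by rewrite /= eqSS.
rewrite eq_sym; case: eqVneq => [ij|_]; last by rewrite filter_pred0.
by rewrite filter_predT ij (negbTE jl) cats0 -[RHS]map_id.
Qed.

Lemma typ_partition t i : is_partition (nth [::] t i).
Proof.
case: (ltnP i (size t)) => h; last by rewrite nth_default.
by case: t h => t /= /and3P[_ /allP + _] h; apply; apply: mem_nth.
Qed.

Lemma typ_size t : size t = n.
Proof. by case: t => t /= /and3P[/eqP]. Qed.

Lemma typ_sum t : \sum_(i < n) i.+1 * sumn (nth [::] t i) = n.
Proof. by case: t => t /= /and3P[_ _ /eqP]. Qed.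

(** The blocks of multiplicity i + 1 give the parts of the corresponding partition up to order, and
    a sorted list is determined by its multiset of entries. *)
Lemma blocks_inj t t' : perm_eq (blocks t) (blocks t') -> t = t'.
Proof.
move=> e; apply: val_inj; apply: (@eq_from_nth _ [::]); rewrite ?typ_size //.
move=> i i_lt; have geq_tr : transitive geq by move=> x y z /= h h'; apply: leq_trans h' h.
have geq_as : antisymmetric geq by move=> x y /=; rewrite andbC => /anti_leq.
have [/andP[s1 _] /andP[s2 _]] := (typ_partition t i, typ_partition t' i).
apply: (sorted_eq geq_tr geq_as s1 s2).
have := perm_map fst (perm_filter (fun p => p.2 == i.+1) e).
by rewrite !blocksE !filter_block_seq ?iota_uniq // mem_iota add0n /= i_lt.
Qed.

Lemma big_block_seq f l (F : nat * nat -> nat) :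
  \sum_(p <- block_seq f l) F p = \sum_(i <- l) \sum_(d <- f i) F (d, i.+1).
Proof. by rewrite /block_seq big_allpairs_dep. Qed.

Lemma sum_blocks f :
  \sum_(i < n) i.+1 * sumn (f i) = \sum_(p <- block_seq f (iota 0 n)) p.1 * p.2.
Proof.
rewrite big_block_seq -(big_mkord xpredT (fun i => i.+1 * sumn (f i))) /index_iota subn0.
by apply: eq_bigr => i _; rewrite sumnE big_distrr; apply: eq_bigr => d _; apply: mulnC.
Qed.

(** Sorting the degrees of each multiplicity gives the partitions. Degrees are positive, so every
    multiplicity is at most n and n partitions suffice. *)
Lemma blocks_surj (bs : seq (nat * nat)) :
  all (fun p => (0 < p.1) && (0 < p.2)) bs -> \sum_(p <- bs) p.1 * p.2 = n ->
  exists t, perm_eq (blocks t) bs.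
Proof.
move=> /allP bs_gt0 bs_sum.
have bs_le p : p \in bs -> p.2 <= n.
  move=> pbs; rewrite -bs_sum (big_rem p) //= (leq_trans _ (leq_addr _ _)) //.
  by rewrite leq_pmull //; case/andP: (bs_gt0 p pbs).
pose f i := sort geq [seq p.1 | p <- bs & p.2 == i.+1].
(* With F arbitrary, this yields both the total degree of the new type and, through indicator
   functions, the equality of multisets. *)
have fsum (F : nat * nat -> nat) :
    \sum_(p <- block_seq f (iota 0 n)) F p = \sum_(p <- bs) F p.
  rewrite big_block_seq.
  transitivity (\sum_(i <- iota 0 n) \sum_(p <- bs | p.2 == i.+1) F p).
    apply: eq_bigr => i _; rewrite (perm_big _ (permEl (perm_sort _ _))) /= big_map big_filter.
    by apply: eq_bigr => -[d r] /= /eqP ->.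
  rewrite (exchange_big_dep xpredT) //= big_seq [RHS]big_seq; apply: eq_bigr => p pbs.
  (* The block p is met for exactly one index, its multiplicity minus 1. *)
  rewrite -big_filter (@perm_big _ _ _ _ _ [:: p.2.-1]) ?big_seq1 //.
  apply: uniq_perm => //; first by rewrite filter_uniq ?iota_uniq.
  move=> i; rewrite mem_filter mem_iota inE.
  have := bs_le p pbs; have /andP[_] := bs_gt0 p pbs.
  by case: (p.2) => // r _ /=; rewrite eqSS eq_sym; case: eqP => // ->.
have ft i : i < n -> nth [::] (mkseq f n) i = f i by move=> h; rewrite nth_mkseq.
have fe : block_seq (nth [::] (mkseq f n)) (iota 0 n) = block_seq f (iota 0 n).
  congr flatten; apply/eq_in_map => i; rewrite mem_iota add0n => /andP[_ h].
  by rewrite ft.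
have ty : is_type n (mkseq f n).
  apply/and3P; split; first by rewrite size_mkseq.
    apply/allP => s /mapP[i _ ->]; apply/andP; split.
      by apply: sort_sorted => x y /=; apply: leq_total.
    rewrite mem_sort; apply/mapP => -[p]; rewrite mem_filter => /andP[_ /bs_gt0].
    by move=> /andP[+ _] p0; rewrite -p0.
  by rewrite sum_blocks fe fsum bs_sum.
exists (MkTyp ty); rewrite blocksE /= fe; apply/permP => a.
rewrite -!sum1_count [LHS]big_mkcond [RHS]big_mkcond /=.
exact: (fsum (fun p => if a p then 1 else 0)).
Qed.

Lemma size_blocks t : size (blocks t) = typ_length t.
Proof.
rewrite blocksE -sum1_size big_block_seq /typ_length.
rewrite -(big_mkord xpredT (fun i => size (nth [::] t i))) /index_iota subn0.
by apply: eq_bigr => i _; rewrite sum1_size.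
Qed.

Lemma blocks_gt0 t p : p \in blocks t -> (0 < p.1) && (0 < p.2).
Proof.
case/allpairsPdep => i [d [_ di ->]] /=; rewrite andbT lt0n.
by have /andP[_] := typ_partition t i; apply: contraNneq => <-.
Qed.

Lemma typ_sumn_le t i : sumn (nth [::] t i) <= n.
Proof.
case: (ltnP i n) => h; last by rewrite nth_default ?typ_size.
rewrite -[X in _ <= X](typ_sum t) (bigD1 (Ordinal h)) //=.
by rewrite (leq_trans _ (leq_addr _ _)) // leq_pmull.
Qed.

Lemma typ_size_le t i : size (nth [::] t i) <= n.
Proof.
apply: leq_trans (typ_sumn_le t i); apply: size_le_sumn.
by case/andP: (typ_partition t i).
Qed.

Lemma typ_part_le t i j : nth 0 (nth [::] t i) j <= n.
Proof. exact: leq_trans (nth_le_sumn _ _) (typ_sumn_le t i). Qed.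

End Types.

(** * The expansion of E_sigma over tilings *)

Section Expansion.
Variables (n : nat) (s : Typ n).

(** Every pair of indices counts as a row; a row outside the diagram gets length 0 from the defaults
    of [nth]. *)
Let row_len (r : 'I_n * 'I_n) : nat := nth 0%N (nth [::] s r.1) r.2.
Let block_weight (p : nat * nat) : series := - subst_pow p.2 (Eplus p.1).

Lemma tiling_set0 (T : {set marked_brick n}) : tiling set0 T = (T == set0).
Proof.
apply/tilingP/eqP => [[H1 _ H3 _]|->].
  apply/setP => b; rewrite inE; apply/negP => bT.
  have [j jb] := brick_nonempty (H1 b bT).
  suff : (b.1.1, j) \in set0 by rewrite inE.
  by apply/H3; exists b; rewrite // mem_brick_cells eqxx.
split=> [b|b b' c|c|b b']; rewrite ?inE //.
by split=> // -[b]; rewrite inE.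
Qed.

(** Rows are tiled independently: [tiling_sum_row] with k = 0 and s = 0 splits off one row at a
    time, and [Elevel] at level 0 is the factor of that row. *)
Lemma tiling_sum_rows (rs : seq ('I_n * 'I_n)) : uniq rs ->
  \sum_(T | tiling [set c : cell n | (c.1 \in rs) && (c.2 < row_len c.1)%N] T)
    \prod_(b in T) block_weight (brick_block b) =
  \prod_(r <- rs) subst_pow r.1.+1 (Eminus (row_len r)).
Proof.
elim: rs => [_|r rs IH /= /andP[rrs /IH {}IH]].
  rewrite big_nil (_ : [set c | _] = set0); last by apply/setP => c; rewrite !inE.
  by rewrite (big_pred1 set0) ?big_set0 // => T; apply: tiling_set0.
rewrite big_cons -{}IH; set D' := [set c | _]; set D := [set c | _].
have -> : D = segment r 0 (row_len r) :|: D'.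
  apply/setP => c; rewrite !inE andb_orl; congr (_ || _).
  by case: eqP => // ->.
rewrite (eq_bigl (tiling_from r 0 (segment r 0 (row_len r) :|: D'))); last first.
  move=> T; rewrite /tiling_from andb_idr // => _.
  by apply/forallP => b; apply/implyP => _; apply/implyP.
rewrite -/(tiling_sum block_weight r 0 _) tiling_sum_row //; last exact: typ_part_le.
  by rewrite subn0 /Elevel dvd1n mul1n divn1.
by move=> c; rewrite inE => /andP[+ _]; apply: contraTneq => ->.
Qed.

Lemma at_typeE (F : nat -> series) (t : Typ n) :
  at_type F t = \prod_(p <- blocks t) subst_pow p.2 (F p.1).
Proof. by rewrite /at_type foldrE big_map. Qed.

(** Since F_0 = 1, the empty rows can be included in the product. *)
Lemma at_type_rows (F : nat -> series) : F 0%N = 1 ->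
  at_type F s = \prod_(r : 'I_n * 'I_n) subst_pow r.1.+1 (F (row_len r)).
Proof.
move=> F0; rewrite at_typeE blocksE /block_seq big_allpairs_dep /=.
rewrite -(pair_bigA _ (fun i j : 'I_n => subst_pow i.+1 (F (row_len (i, j))))) /=.
have -> : iota 0 n = index_iota 0 n by rewrite /index_iota subn0.
rewrite big_mkord; apply: eq_bigr => i _.
rewrite /row_len /=; set l := nth [::] s i.
rewrite (big_nth 0%N) (big_nat_widen _ _ _ _ _ (typ_size_le s i)) big_mkord big_mkcond.
apply: eq_bigr => j _ /=; case: ltnP => // h.
by rewrite nth_default // F0 subst_pow1.
Qed.

Lemma at_type_Eminus_tilings : at_type Eminus s =
  \sum_(T | tiling (tensor_diagram s) T) \prod_(b in T) block_weight (brick_block b).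
Proof.
rewrite at_type_rows ?Eminus0 // -big_enum -tiling_sum_rows ?enum_uniq //=.
apply: eq_bigl => T; congr (tiling _ T); apply/setP => c.
by rewrite !inE mem_enum.
Qed.

Lemma is_dyadic_tabloidE (t : Typ n) T : is_dyadic_tabloid s t T =
  tiling (tensor_diagram s) T && perm_eq (blocks t) [seq brick_block b | b <- enum T].
Proof. by rewrite /is_dyadic_tabloid /tiling -!andbA. Qed.

Lemma sum_cells (b : marked_brick n) :
  (\sum_(c in brick_cells b) c.1.1.+1 = brick_length b * b.1.1.1.+1)%N.
Proof.
have -> : brick_cells b = [set (b.1.1, j) | j in b.1.2].
  apply/setP => c; rewrite mem_brick_cells; apply/andP/imsetP => [[/eqP e h]|[j jb ->]].
    by exists c.2; rewrite // -e; case: (c).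
  by rewrite eqxx.
rewrite big_imset /=; last by move=> j j' _ _ [].
by rewrite sum_nat_const.
Qed.

Lemma sum_tensor_diagram : (\sum_(c in tensor_diagram s) c.1.1.+1 = n)%N.
Proof.
rewrite -[RHS](typ_sum s).
transitivity (\sum_(r : 'I_n * 'I_n) \sum_(j : 'I_n | j < row_len r) r.1.+1)%N.
  rewrite pair_big_dep /=; apply: eq_bigl => c; by rewrite inE.
rewrite -(pair_bigA _ (fun i k : 'I_n => \sum_(j < n | j < row_len (i, k)) i.+1)%N) /=.
apply: eq_bigr => i _; rewrite sumnE big_distrr /= (big_nth 0%N).
rewrite (big_nat_widen _ _ _ _ _ (typ_size_le s i)) big_mkord [RHS]big_mkcond /=.
apply: eq_bigr => k _; rewrite -(big_ord_widen _ (fun=> i.+1)) ?typ_part_le //.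
rewrite sum_nat_const card_ord mulnC; case: ltnP => // h.
by rewrite /row_len /= nth_default ?muln0.
Qed.

(** Give each cell of the m-th tensor factor weight m. A k-brick of length 2^k b there weighs 2^k b
    m, the degree times the multiplicity of its block, and the whole diagram weighs n. *)
Lemma tiling_block_sum T : tiling (tensor_diagram s) T ->
  (\sum_(b in T) (brick_block b).1 * (brick_block b).2 = n)%N.
Proof.
move=> /tilingP[H1 H2 H3 _]; rewrite -[RHS]sum_tensor_diagram.
transitivity (\sum_(b in T) \sum_(c in brick_cells b) c.1.1.+1)%N.
  apply: eq_bigr => b /H1 /andP[_ dv].
  by rewrite sum_cells /brick_block /= mulnA divnK.
rewrite (exchange_big_dep (mem (tensor_diagram s))) /=; last first.
  by move=> b c bT cb; apply/H3; exists b.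
apply: eq_bigr => c /H3[b bT cb].
rewrite (big_pred1 b) // => b'; apply/andP/eqP => [[b'T cb']|-> //].
exact: H2 cb' cb.
Qed.

(** It ensures that grouping the tilings by content in Typ(n) loses none of them. *)
Lemma tiling_content T : tiling (tensor_diagram s) T ->
  exists t : Typ n, perm_eq (blocks t) [seq brick_block b | b <- enum T].
Proof.
move=> tT; apply: blocks_surj; last by rewrite big_map big_enum; apply: tiling_block_sum.
apply/allP => p /mapP[b]; rewrite mem_enum => bT -> /=.
have /tilingP[H1 _ _ _] := tT; have /andP[_ dv] := H1 b bT.
rewrite muln_gt0 expn_gt0 /= andbT divn_gt0 ?expn_gt0 // dvdn_leq //.
have [j jb] := brick_nonempty (H1 b bT).
by apply/card_gt0P; exists j.
Qed.

Lemma prod_block_weight (t : Typ n) (T : {set marked_brick n}) :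
  perm_eq (blocks t) [seq brick_block b | b <- enum T] ->
  \prod_(b in T) block_weight (brick_block b) = (-1) ^+ typ_length t * at_type Eplus t.
Proof.
move=> e; rewrite -big_enum -(big_map (@brick_block n) xpredT block_weight) /=.
rewrite -(perm_big _ e) /= at_typeE -size_blocks /block_weight.
elim: (blocks t) => [|p l IH]; first by rewrite !big_nil mulr1.
by rewrite !big_cons IH /= exprS mulN1r !mulNr mulrCA.
Qed.

Lemma at_type_Eminus_Eplus : at_type Eminus s =
  \sum_(t : Typ n) ((-1) ^+ typ_length t * #|PT_dyad s t|%:R) * at_type Eplus t.
Proof.
rewrite at_type_Eminus_tilings.
(* Each tiling has exactly one content: it exists by [tiling_content] and is unique by
   [blocks_inj]. *)
transitivity (\sum_(T | tiling (tensor_diagram s) T)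
   \sum_(t : Typ n | perm_eq (blocks t) [seq brick_block b | b <- enum T])
      (-1) ^+ typ_length t * at_type Eplus t).
  apply: eq_bigr => T tT; have [t et] := tiling_content tT.
  rewrite (prod_block_weight et) (big_pred1 t) // => t'; apply/idP/eqP => [e|-> //].
  by apply: blocks_inj; rewrite (perm_trans e) // perm_sym.
rewrite (exchange_big_dep xpredT) //=; apply: eq_bigr => t _.
rewrite (eq_bigl (fun T => T \in PT_dyad s t)) => [|T]; last by rewrite inE is_dyadic_tabloidE.
by rewrite sumr_const mulrAC mulr_natr.
Qed.

End Expansion.

(** * Total degree, positivity and the monomials of products of E^+ *)

Lemma ucm_monomialE (x y : indet) : (ucm x : monomial) y = (x == y).
Proof. exact: ucmE. Qed.

Lemma mdeg_mulcm (m m' : monomial) : mdeg (mulcm m m') = (mdeg m + mdeg m')%N.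
Proof. exact: mdegM. Qed.

Lemma mdeg_pow r (m : monomial) : mdeg (pow_monomial r m) = (mdeg m * r)%N.
Proof.
rewrite (@mdegEw _ _ (finsupp m)).
  by rewrite mdegE big_distrl; apply: eq_bigr => x _; rewrite pow_monomialE.
apply/fsubsetP => x; rewrite !mem_finsupp pow_monomialE muln_eq0 negb_or.
by case/andP.
Qed.

Lemma wdeg_ucm (x : indet) : wdeg (ucm x) = x.1.+1.
Proof.
rewrite (@wdegE _ [fset x]%fset) => [|y]; last first.
  by rewrite mem_finsupp ucm_monomialE eqb0 negbK inE eq_sym.
by rewrite big_seq_fset1 ucm_monomialE eqxx mul1n.
Qed.

Lemma mdeg_eq1 (m : monomial) : mdeg m = 1%N -> exists x : indet, m = ucm x.
Proof.
move=> m1; have [x xm] : exists x, x \in finsupp m.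
  by apply/fset0Pn/eqP => h; move: m1; rewrite mdegE h big_seq_fset0.
exists x; have e : m = mulcm (ucm x) (divcm m (ucm x)).
  apply: cmonomP => y; rewrite mulcmE divcmE ucm_monomialE subnKC //.
  by case: eqP => // <-; rewrite lt0n -mem_finsupp.
move: m1; rewrite e mdeg_mulcm mdegU add1n => -[/mdeg_eq0I ->].
exact: mulcm0.
Qed.

Lemma Eplus_ge0 d m : 0 <= Eplus d m.
Proof. by rewrite /Eplus; case: ifP. Qed.

Lemma subst_pow_ge0 r (f : series) : (forall m, 0 <= f m) ->
  forall m, 0 <= subst_pow r f m.
Proof. by move=> f0 m; rewrite /subst_pow; case: ifP. Qed.

Lemma mul_series_ge0 (f g : series) : (forall m, 0 <= f m) -> (forall m, 0 <= g m) ->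
  forall m, 0 <= (f * g) m.
Proof. by move=> f0 g0 m; rewrite mul_seriesE sumr_ge0 // => d _; rewrite mulr_ge0. Qed.

(** Nonnegative coefficients cannot cancel the term of the factorization a b. *)
Lemma mul_series_gt0 (f g : series) a b : (forall m, 0 <= f m) -> (forall m, 0 <= g m) ->
  0 < f a -> 0 < g b -> 0 < (f * g) (mulcm a b).
Proof.
move=> f0 g0 fa gb; rewrite mul_seriesE (bigD1_seq a) ?divisors_uniq //=; last first.
  by apply/divisorsP => x; rewrite mulcmE leq_addr.
rewrite (_ : divcm _ a = b); last by apply: cmonomP => x; rewrite divcmE mulcmE addKn.
by rewrite ltr_wpDr ?mulr_gt0 // sumr_ge0 // => d _; rewrite mulr_ge0.
Qed.

(** The list of blocks is arbitrary here, which permits induction on it. *)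
Definition Eblocks (bs : seq (nat * nat)) : series :=
  \prod_(p <- bs) subst_pow p.2 (Eplus p.1).

Lemma Eblocks_ge0 bs m : 0 <= Eblocks bs m.
Proof.
rewrite /Eblocks; elim: bs m => [|p bs IH] m.
  by rewrite big_nil series1E; case: eqP.
rewrite big_cons; apply: mul_series_ge0 => //.
by apply: subst_pow_ge0 => ?; apply: Eplus_ge0.
Qed.

(* The pair (x, r) stands for the power x^r of the indeterminate x; it comes
   from the block (deg x)^r. *)
Definition power_product (l : seq (indet * nat)) : monomial :=
  foldr (fun xr m => mulcm (pow_monomial xr.2 (ucm xr.1)) m) (onecm indet) l.

Definition power_block (xr : indet * nat) : nat * nat := (xr.1.1.+1, xr.2).

(** The factor of a block d^r contains y^r for every indeterminate y of degree d; one such power is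
    taken from each factor. *)
Lemma Eblocks_gt0 l : all (fun xr => 0 < xr.2)%N l ->
  0 < Eblocks (map power_block l) (power_product l).
Proof.
elim: l => [_|[x r] l IH /= /andP[r0 /IH h]].
  by rewrite /Eblocks big_nil series1E eqxx.
rewrite /Eblocks big_cons; apply: mul_series_gt0 h.
- by apply: subst_pow_ge0 => ?; apply: Eplus_ge0.
- exact: Eblocks_ge0.
rewrite subst_powE //= /Eplus wdeg_ucm eqxx andbT ifT //.
by apply/forallP => y; rewrite ucm_monomialE leq_b1.
Qed.

Lemma power_product_supp l : all (fun xr => 0 < xr.2)%N l ->
  finsupp (power_product l) =i map fst l.
Proof.
elim: l => [_|[x r] l IH /= /andP[r0 /IH h]] y.
  by rewrite mem_finsupp onecmE.
rewrite inE -h !mem_finsupp mulcmE pow_monomialE ucm_monomialE addn_eq0 muln_eq0.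
by rewrite (gtn_eqF r0) orbF eqb0 negb_and negbK eq_sym.
Qed.

Lemma power_productE l : uniq (map fst l) ->
  map power_block l = [seq (x.1.+1, power_product l x) | x <- map fst l].
Proof.
elim: l => [//|[x r] l IH] /= /andP[xl /IH ->]; congr (_ :: _).
  rewrite /power_block mulcmE pow_monomialE ucm_monomialE eqxx mul1n /=.
  suff -> : power_product l x = 0%N by rewrite addn0.
  elim: l xl {IH} => [_|[y q] l IH] /=; first by rewrite onecmE.
  rewrite inE negb_or eq_sym => /andP[/negbTE xy /IH e].
  by rewrite mulcmE e pow_monomialE ucm_monomialE xy.
apply/eq_in_map => y yl; rewrite mulcmE pow_monomialE ucm_monomialE.
by case: eqP => // e; move: xl; rewrite e yl.
Qed.

Lemma power_product_size l : all (fun xr => 0 < xr.2)%N l ->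
  (#|` finsupp (power_product l)| <= size l)%N.
Proof.
move=> l0; rewrite -(size_map fst) uniq_leq_size ?fset_uniq // => x.
by rewrite (power_product_supp l0).
Qed.

(** As many distinct indeterminates as entries means that none repeats, so each exponent in the
    product is the multiplicity of a single block. *)
Lemma perm_power_blocks l : all (fun xr => 0 < xr.2)%N l ->
  size l = #|` finsupp (power_product l)| ->
  perm_eq (map power_block l)
    [seq (x.1.+1, power_product l x) | x <- finsupp (power_product l)].
Proof.
move=> l0 sl; have e := power_product_supp l0.
have ul : uniq (map fst l).
  by rewrite -(eq_uniq _ e) ?fset_uniq // size_map.
rewrite power_productE //; apply/perm_map; rewrite perm_sym.
by apply: uniq_perm; rewrite ?fset_uniq.
Qed.

Lemma mdeg_power_product l : mdeg (power_product l) = (\sum_(xr <- l) xr.2)%N.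
Proof.
elim: l => [|xr l IH]; first by rewrite big_nil; apply: mdeg1.
by rewrite big_cons /= mdeg_mulcm IH mdeg_pow mdegU mul1n.
Qed.

(** A monomial in the factor of d^r is an r-th power of a monomial of weighted degree d > 0. Its
    total degree is therefore at least r, with equality only for a power of one indeterminate.
    Equality of the totals forces equality in every factor. *)
Lemma Eblocks_supp bs (m : monomial) :
  all (fun p => (0 < p.1) && (0 < p.2))%N bs ->
  Eblocks bs m != 0 ->
  (\sum_(p <- bs) p.2 <= mdeg m)%N /\
  (mdeg m = (\sum_(p <- bs) p.2)%N ->
    exists2 l, m = power_product l & map power_block l = bs).
Proof.
rewrite /Eblocks; elim: bs m => [|[d r] bs IH] m /=.
  rewrite !big_nil series1E; case: (m =P onecm indet) => [-> _ _|_ _]; last by rewrite eqxx.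
  by split=> // _; exists [::].
case/andP => /andP[d0 r0] bs0; rewrite !big_cons /= mul_seriesE => mn0.
(* A nonzero coefficient of the product has a nonzero term, that of a factorization m = a b. *)
have [a adiv] : exists2 a, a \in divisors m &
    subst_pow r (Eplus d) a * (\prod_(p <- bs) subst_pow p.2 (Eplus p.1)) (divcm m a) != 0.
  apply/hasP; apply: contraR mn0 => /hasPn h; rewrite big_seq big1 // => a /h.
  by rewrite negbK => /eqP.
rewrite mulf_eq0 negb_or => /andP[an0 bn0]; have [le_b eq_b] := IH _ bs0 bn0.
move: adiv => /mem_divisors/esym; set b := divcm m a in bn0 le_b eq_b * => ->.
case: (subst_powP r a) an0 => [[a' ->]|->]; last by rewrite eqxx.
rewrite subst_powE // /Eplus; case: ifP => [/andP[_ /eqP wa]|]; last by rewrite eqxx.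
have a0 : (0 < mdeg a')%N.
  rewrite lt0n; apply/eqP => /mdeg_eq0I a1; move: d0.
  by rewrite -wa lt0n wdeg_eq0 a1 eqxx.
move=> _; rewrite mdeg_mulcm mdeg_pow; split.
  by rewrite leq_add // leq_pmull.
move=> eqr; have a1 : mdeg a' = 1%N by nia.
have [x ax] := mdeg_eq1 a1; have [|l bl lbs] := eq_b; first by nia.
exists ((x, r) :: l); rewrite /= ?ax -?bl ?lbs //.
by rewrite /power_block /= -wa ax wdeg_ucm.
Qed.

(** * Triangularity and linear independence *)

Section Independence.
Variable n : nat.
Implicit Types t u : Typ n.

Lemma at_type_Eblocks t : at_type Eplus t = Eblocks (blocks t).
Proof. exact: at_typeE. Qed.

Lemma blocks_all t : all (fun p => (0 < p.1) && (0 < p.2))%N (blocks t).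
Proof. by apply/allP => p; apply: blocks_gt0. Qed.

(* One indeterminate x_{d,q} of its own for each block d^r, in position q. *)
Definition typ_powers t : seq (indet * nat) :=
  [seq ((p.1.1.-1, p.2), p.1.2) | p <- zip (blocks t) (iota 0 (size (blocks t)))].

Lemma power_block_typ t : map power_block (typ_powers t) = blocks t.
Proof.
have e : unzip1 (zip (blocks t) (iota 0 (size (blocks t)))) = blocks t.
  by rewrite unzip1_zip ?size_iota.
rewrite -map_comp -[RHS]e; apply/eq_in_map => -[p q] h.
have : p \in blocks t by rewrite -e; apply/mapP; exists (p, q).
by move=> /blocks_gt0; case: p {h} => d r /andP[/= d0 _]; rewrite /power_block /= prednK.
Qed.

Lemma typ_powers_gt0 t : all (fun xr => 0 < xr.2)%N (typ_powers t).
Proof.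
apply/allP => xr h; have /blocks_gt0/andP[] // : power_block xr \in blocks t.
by rewrite -power_block_typ map_f.
Qed.

Lemma typ_powers_uniq t : uniq (map fst (typ_powers t)).
Proof.
apply: (@map_uniq _ _ snd); rewrite -!map_comp.
rewrite (eq_map (g := snd)) // -/(unzip2 _) unzip2_zip ?iota_uniq //.
by rewrite size_iota.
Qed.

Definition typ_monomial t : monomial := power_product (typ_powers t).

Definition typ_mult t : nat := (\sum_(p <- blocks t) p.2)%N.

Lemma typ_monomial_size t : #|` finsupp (typ_monomial t)| = typ_length t.
Proof.
rewrite -size_blocks -(power_block_typ t) size_map -(size_map fst).
apply: perm_size; apply: uniq_perm; rewrite ?fset_uniq ?typ_powers_uniq //.
exact: power_product_supp (typ_powers_gt0 t).
Qed.

Lemma perm_typ_monomial t :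
  perm_eq (blocks t) [seq (x.1.+1, typ_monomial t x) | x <- finsupp (typ_monomial t)].
Proof.
rewrite -[X in perm_eq X _]power_block_typ; apply: perm_power_blocks.
  exact: typ_powers_gt0.
by rewrite typ_monomial_size -size_blocks -(power_block_typ t) size_map.
Qed.

Lemma mdeg_typ_monomial t : mdeg (typ_monomial t) = typ_mult t.
Proof.
rewrite mdeg_power_product /typ_mult -power_block_typ big_map.
exact: eq_bigr.
Qed.

Lemma typ_length_le t : (typ_length t <= n)%N.
Proof.
rewrite -size_blocks -[leqRHS](typ_sum t) sum_blocks -blocksE -sum1_size.
rewrite big_seq [leqRHS]big_seq leq_sum // => p /blocks_gt0 /andP[p1 p2].
by rewrite muln_gt0 p1.
Qed.

(** If the total multiplicities agree, [Eblocks_supp] makes the monomial of t a product of one power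
    per block of u. It has as many distinct indeterminates as t has blocks, so u has at least that
    many; if the numbers agree, the blocks of u can be read off and are those of t. *)
Lemma Eplus_triangular t u : at_type Eplus u (typ_monomial t) != 0 ->
  [\/ u = t, (typ_mult u < typ_mult t)%N |
     typ_mult u = typ_mult t /\ (typ_length t < typ_length u)%N].
Proof.
rewrite at_type_Eblocks => /(Eblocks_supp (blocks_all u)).
rewrite mdeg_typ_monomial -/(typ_mult u) leq_eqVlt => -[/orP[/eqP eq_m|lt_m] h]; last first.
  by constructor 2.
have [l tl lu] := h (esym eq_m).
have l0 : all (fun xr => 0 < xr.2)%N l.
  apply/allP => xr xl; have /blocks_gt0/andP[] // : power_block xr \in blocks u.
  by rewrite -lu map_f.
have sl : size l = typ_length u by rewrite -size_blocks -lu size_map.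
have := power_product_size l0; rewrite -tl typ_monomial_size sl leq_eqVlt.
case/orP => [/eqP eq_l|lt_l]; last by constructor 3.
constructor 1; apply: blocks_inj.
rewrite (permPr (perm_typ_monomial t)) -lu tl perm_power_blocks //.
by rewrite -tl typ_monomial_size sl.
Qed.

Lemma Eplus_diagonal t : at_type Eplus t (typ_monomial t) != 0.
Proof.
rewrite at_type_Eblocks -power_block_typ gt_eqF //.
exact: Eblocks_gt0 (typ_powers_gt0 t).
Qed.

Lemma Eplus_free (c : Typ n -> rat) :
  (forall m, \sum_(t : Typ n) c t * at_type Eplus t m = 0) -> forall t, c t = 0.
Proof.
move=> c0 t0; apply/eqP; apply: contraT => ct0.
(* The rank encodes the lexicographic order: smaller total multiplicity first, then more blocks. The
   second summand is at most n, hence the factor n + 1. For t of minimal rank with c t nonzero, only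
   t contributes to the coefficient of its own monomial. *)
pose rank t := (typ_mult t * n.+1 + (n - typ_length t))%N.
have [t ct t_min] := @arg_minnP _ t0 (fun t => c t != 0) rank ct0.
have := c0 (typ_monomial t); rewrite (bigD1 t) //= big1 => [|u ut].
  by rewrite addr0 => /eqP; rewrite mulf_eq0 (negbTE ct) (negbTE (Eplus_diagonal t)).
case: (eqVneq (c u) 0) => [->|cu]; first by rewrite mul0r.
case: (eqVneq (at_type Eplus u (typ_monomial t)) 0) => [->|/Eplus_triangular].
  by rewrite mulr0.
have := t_min u cu; rewrite /rank; have := typ_length_le t; have := typ_length_le u.
by move=> lu lt le_tu [/eqP|lt_ut|[eq_ut lt_tu]]; [rewrite (negbTE ut)|nia|nia].
Qed.

End Independence.

(** On the left the sign and the integer are elements of the ring of series, on the right they are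
    rational scalars. *)
Lemma sign_scaleE (l k : nat) (f : series) m :
  (((-1) ^+ l * k%:R) * f) m = (-1) ^+ l * k%:R * f m.
Proof.
have natE : (k%:R * f) m = k%:R * f m.
  rewrite !mulr_natl; elim: k => [|k IH]; first by rewrite !mulr0n.
  by rewrite !mulrS add_seriesE IH.
rewrite -!mulrA -signr_odd -[in RHS]signr_odd.
by case: odd; rewrite ?expr1 ?mulN1r ?mul1r ?opp_seriesE ?natE.
Qed.

Theorem theorem50 (n : nat) (sigma tau : Typ n) :
  exists c : {ffun Typ n -> rat},
    unique (is_expansion (at_type Eplus (n := n)) (at_type Eminus sigma)) c
    /\ c tau = ((-1) ^+ typ_length tau * #|PT_dyad sigma tau|%:R)%R.
Proof.
pose c := [ffun t => (-1) ^+ typ_length t * #|PT_dyad sigma t|%:R : rat].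
have cP : is_expansion (at_type Eplus (n := n)) (at_type Eminus sigma) c.
  move=> m; rewrite at_type_Eminus_Eplus sum_seriesE; apply: eq_bigr => t _.
  by rewrite sign_scaleE ffunE.
exists c; split; last by rewrite ffunE.
(* The difference of two expansions is a vanishing combination of the E^+_t. *)
split=> // c' c'P; apply/ffunP => t; apply/eqP; rewrite -subr_eq0; apply/eqP.
move: t; apply: Eplus_free => m.
under eq_bigr => t _ do rewrite mulrBl.
by rewrite sumrB -cP -c'P subrr.
Qed.
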